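(* Let $B$, $\mathrm{BP}$, $\mathrm{BP}'$ be the busy beaver functions defined in the context. Then: (i) There exists a constant $c$ such that $\mathrm{BP}(n)\le \mathrm{BP}'(n+c)$ and $\mathrm{BP}'(n)\le B(n+c)$ for all $n$. (ii) There exists a constant $c$ such that $B(n)\le \mathrm{BP}(n+\mathrm{KP}(n)+c)$ for all $n$. (iii) Let $(x_n,y_n)$ be a sequence of pairs of natural numbers such that $x_n\le y_n$ for all $n$, the sequence $(x_n)$ is lower semicomputable, and the sequence $(y_n)$ is upper semicomputable. Assume that $\sum_n 2^{x_n-y_n}<+\infty$. Then there exists $c$ such that $B(x_n)\le \mathrm{BP}(y_n+c)$ for all $n$.
   Context: Fix an optimal (plain) decompressor $D$ (a partial computable function from binary strings to natural numbers giving minimal complexity up to an additive constant); $\mathrm{KS}(N)$ denotes the plain Kolmogorov complexity of $N$, i.e. the minimal length of a string $p$ with $D(p)=N$. Fix an optimal prefix-free decompressor; $\mathrm{KP}(N)$ denotes the resulting prefix Kolmogorov complexity. Fix a discrete a priori probability $\mathbf m$: a lower semicomputable sequence of non-negative reals $\mathbf m(k)$ with $\sum_k \mathbf m(k)$ convergent that is maximal up to a multiplicative constant among all such sequences (so $\mathbf m(k)=2^{-\mathrm{KP}(k)+O(1)}$). Define $B(n)=\max\{N : \mathrm{KS}(N)\le n\}$, $\mathrm{BP}(n)=\max\{N:\mathrm{KP}(N)\le n\}$, and $\mathrm{BP}'(n)$ = the minimal $N$ such that $\sum_{k>N}\mathbf m(k)<2^{-n}$. A sequence $(y_n)$ of natural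 numbers is lower (resp. upper) semicomputable if $y_n=\lim_k y(n,k)$ for a total computable function $y(\cdot,\cdot)$ non-decreasing (resp. non-increasing) in $k$. *)

(* Defs.v *)
From mathcomp Require Import all_boot all_order all_algebra.
From mathcomp Require Import all_classical all_reals all_analysis.

Set Implicit Arguments.
Unset Strict Implicit.
Unset Printing Implicit Defensive.

Import Order.TTheory GRing.Theory Num.Theory.
Import numFieldNormedType.Exports.

Local Open Scope classical_set_scope.
Local Open Scope ring_scope.

(* Kleene's mu-recursive functions: [recf n] is the type of (descriptions of)
   n-ary partial recursive functions. *)
Inductive recf : nat -> Type :=
| RZero : recf 0
| RSucc : recf 1
| RProj n (i : 'I_n) : recf n
| RComp m n (f : recf m) (g : 'I_m -> recf n) : recf n
| RPrec n (f : recf n) (g : recf n.+2) : recf n.+1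
| RMu n (f : recf n.+1) : recf n.

(* [rec_eval f v y] : the computation of f on v halts with value y. The recursion
   variable of [RPrec] and the search variable of [RMu] come first, and the step
   function of [RPrec] takes the counter, the previous value and the parameters.
   In [RMu f], f must be defined and nonzero below the returned value. *)
Fixpoint rec_eval n (f : recf n) : n.-tuple nat -> nat -> Prop :=
  match f in recf n return n.-tuple nat -> nat -> Prop with
  | RZero => fun _ y => y = 0%N
  | RSucc => fun v y => y = (thead v).+1
  | RProj _ i => fun v y => y = tnth v i
  | RComp m _ f g => fun v y =>
      exists w : m.-tuple nat,
        (forall i, rec_eval (g i) v (tnth w i)) /\ rec_eval f w y
  | RPrec _ f g => fun v y =>
      let t := [tuple of behead v] in
      exists h : nat -> nat,
        [/\ rec_eval f t (h 0%N),
            (forall k, (k < thead v)%N ->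
               rec_eval g [tuple of k :: h k :: t] (h k.+1))
          & y = h (thead v)]
  | RMu _ f => fun v y =>
      rec_eval f [tuple of y :: v] 0%N /\
      (forall k, (k < y)%N -> exists z, rec_eval f [tuple of k :: v] z.+1)
  end.

Definition computable2 (f : nat -> nat -> nat) : Prop :=
  exists c : recf 2, forall a b y, rec_eval c [tuple a; b] y <-> f a b = y.

Definition computable2_rat (q : nat -> nat -> rat) : Prop :=
  exists a b d : nat -> nat -> nat,
    [/\ computable2 a, computable2 b, computable2 d
      & forall i j, q i j = ((a i j)%:R - (b i j)%:R) / (d i j).+1%:R].

(* The bijection between binary strings and naturals given by bijective base-2
   numeration, least significant digit first, with digits 1 (false) and
   2 (true). *)
Fixpoint string_code (p : seq bool) : nat :=
  if p is b :: p' then (b + (string_code p').*2).+1 else 0%N.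

Definition partial_computable (D : seq bool -> option nat) : Prop :=
  exists c : recf 1,
    forall p y, rec_eval c [tuple string_code p] y <-> D p = Some y.

(* Pointwise comparison of complexities up to an additive constant, where a
   number without description has infinite complexity. *)
Definition not_worse (D D' : seq bool -> option nat) : Prop :=
  exists c : nat, forall p' N, D' p' = Some N ->
    exists p, D p = Some N /\ (size p <= size p' + c)%N.

Definition optimal_decompressor (D : seq bool -> option nat) : Prop :=
  partial_computable D /\
  forall D', partial_computable D' -> not_worse D D'.

Definition prefix_free (D : seq bool -> option nat) : Prop :=
  forall p q, D p != None -> D q != None -> prefix p q -> p = q.

Definition optimal_prefix_free_decompressor (D : seq bool -> option nat) : Prop :=
  [/\ partial_computable D, prefix_free D
    & forall D', partial_computable D' -> prefix_free D' -> not_worse D D'].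

(* Both default to 0 when there is no extremum. *)
Definition nat_min (A : set nat) : nat := xget 0%N (A `&` lbound A).
Definition nat_max (A : set nat) : nat := xget 0%N (A `&` ubound A).

(* KS when D is an optimal decompressor, KP when D is an optimal prefix-free
   decompressor; every number then has a description, so the default value of
   [nat_min] is not used. *)
Definition complexity (D : seq bool -> option nat) (N : nat) : nat :=
  nat_min [set size p | p in [set p | D p = Some N]].

(* B for plain, BP for prefix-free D. The set is finite; the default value 0 is
   taken only when it is empty, i.e. for finitely many n if D is optimal. *)
Definition busy_beaver (D : seq bool -> option nat) (n : nat) : nat :=
  nat_max [set N | (complexity D N <= n)%N].

Definition lower_semicomputable_real (R : realType) (m : nat -> R) : Prop :=
  exists q : nat -> nat -> rat,
    [/\ computable2_rat q,
        (forall n, nondecreasing_seq (q n))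
      & forall n, (ratr (q n k) : R) @[k --> \oo] --> m n].

Definition semicomputable_summable (R : realType) (m : nat -> R) : Prop :=
  [/\ lower_semicomputable_real m, (forall k, 0 <= m k) & cvgn (series m)].

Definition a_priori_probability (R : realType) (m : nat -> R) : Prop :=
  semicomputable_summable m /\
  forall m' : nat -> R, semicomputable_summable m' ->
    exists c : R, 0 < c /\ forall k, m' k <= c * m k.

(* BP'. *)
Definition busy_beaver_tail (R : realType) (m : nat -> R) (n : nat) : nat :=
  nat_min [set N | (\sum_(N.+1 <= k <oo) (m k)%:E < (2 ^- n)%:E)%E].

Definition lower_semicomputable_nat (x : nat -> nat) : Prop :=
  exists y : nat -> nat -> nat,
    [/\ computable2 y,
        (forall n, nondecreasing_seq (y n))
      & forall n, y n k @[k --> \oo] --> x n].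

Definition upper_semicomputable_nat (x : nat -> nat) : Prop :=
  exists y : nat -> nat -> nat,
    [/\ computable2 y,
        (forall n, nonincreasing_seq (y n))
      & forall n, y n k @[k --> \oo] --> x n].

(* Main.v *)
Require Import Defs.
From mathcomp Require Import all_boot all_order all_algebra.
From mathcomp Require Import all_classical all_reals all_analysis.
From mathcomp Require Import zify lra ring.

(* BP <= BP': since 2^-KP is lower semicomputable with sum at most 1, it is
   dominated by m, so a number N with KP(N) <= n has mass at least 2^-(n+c) and
   cannot lie in a tail of smaller mass.

   BP' <= B: an approximation of the total mass from below with error less than
   2^-n, which takes n + O(1) bits, gives a stage of the enumeration of m after
   which less than 2^-n remains to appear.

   B(x_n) <= BP(y_n + c): whenever a program r of length at most x_n is seen to
   halt, a codeword of length y_n + O(1) is requested for its output, and again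
   each time the upper bound for y_n drops. The requests for n cost at most
   4 * 2^(x_n - y_n), so the Kraft-Chaitin construction turns them into a prefix-free
   decompressor. The case x_n = n, y_n = n + KP(n) is statement (ii). *)

(** The semantics of [recf] is a relation without a clock, so waiting for a program to halt is
    expressed by a total recursive function of a stage, monotone in the stage. Upper bounds on
    complexity all come from optimality: it suffices to exhibit some decompressor, which is always
    an unbounded search for the first index that passes a decidable test.

    The interval of a request starts at the sum of all earlier costs, so the request lengths have to
    be a total function of the index. The index therefore ranges over all numbers: those that code a
    triple (n, program, stage) at which something is requested carry a genuine request, and every
    other index [i] carries a filler of length [i.+1].

    The factor 4 is a product of two factors 2. At most 2^(x_n + 1) strings have length at most x_n,
    and the lengths requested for one program strictly decrease, so that their total cost is at most
    twice the last one. *)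

Set Implicit Arguments.
Unset Strict Implicit.
Unset Printing Implicit Defensive.

Import Order.TTheory GRing.Theory Num.Theory.
Import numFieldNormedType.Exports.

(** * Total recursive functions *)

(* The arguments of an [n]-ary function are given as a list, so that binding a
   variable is consing; the variables are then [head 0 v],
   [head 0 (behead v)], etc. *)
Definition recursive n (F : seq nat -> nat) : Prop :=
  exists c : recf n, forall (v : n.-tuple nat) y, rec_eval c v y <-> F v = y.

Lemma recursive_ext n (F G : seq nat -> nat) : (forall v : n.-tuple nat, F v = G v) ->
  recursive n F -> recursive n G.
Proof. by move=> FG [c cF]; exists c => v y; rewrite -FG. Qed.

Lemma recursive_comp n m F (G : m.-tuple (seq nat -> nat)) :
  recursive m F -> (forall i, recursive n (tnth G i)) ->
  recursive n (fun v => F [seq g v | g <- G]).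
Proof.
move=> [cf Hf] /boolp.choice[cg Hg]; exists (RComp cf cg) => v y /=; split.
  move=> [w [Hw]] /Hf <-.
  suff -> : w = (map_tuple (fun g : seq nat -> nat => g v) G) by [].
  by apply: eq_from_tnth => i; rewrite tnth_map; apply/esym/Hg.
move=> <-; exists (map_tuple (fun g : seq nat -> nat => g v) G);
  split=> [i|]; last exact/Hf.
by apply/Hg; rewrite tnth_map.
Qed.

Lemma recursive_nth n i : i < n -> recursive n (fun v => nth 0 v i).
Proof.
move=> lt_in; exists (RProj (Ordinal lt_in)) => v y /=.
by rewrite (tnth_nth 0); split=> ->.
Qed.

Lemma recursive_var0 n : recursive n.+1 (fun v => head 0 v).
Proof. by apply: recursive_ext (recursive_nth (ltn0Sn n)) => v; rewrite nth0. Qed.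

Lemma recursive_var1 n : recursive n.+2 (fun v => head 0 (behead v)).
Proof.
have : 1 < n.+2 by [].
by move/recursive_nth; apply: recursive_ext => v; rewrite -nth0 nth_behead.
Qed.

Lemma recursive_var2 n : recursive n.+3 (fun v => head 0 (behead (behead v))).
Proof.
have : 2 < n.+3 by [].
by move/recursive_nth; apply: recursive_ext => v; rewrite -nth0 !nth_behead.
Qed.

Lemma recursive_var3 n :
  recursive n.+4 (fun v => head 0 (behead (behead (behead v)))).
Proof.
have : 3 < n.+4 by [].
by move/recursive_nth; apply: recursive_ext => v; rewrite -nth0 !nth_behead.
Qed.

Lemma recursive_comp1 n (f : nat -> nat) G :
  recursive 1 (fun v => f (head 0 v)) -> recursive n G ->
  recursive n (fun v => f (G v)).
Proof.
move=> rf rG; apply: (@recursive_comp n 1 _ [tuple G] rf) => i.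
by rewrite (ord1 i).
Qed.

Lemma recursive_comp2 n (f : nat -> nat -> nat) G H :
  recursive 2 (fun v => f (head 0 v) (head 0 (behead v))) ->
  recursive n G -> recursive n H -> recursive n (fun v => f (G v) (H v)).
Proof.
move=> rf rG rH; apply: (@recursive_comp n 2 _ [tuple G; H] rf).
by case=> [[|[|//]] ?].
Qed.

Lemma recursive_comp3 n (f : nat -> nat -> nat -> nat) G H K :
  recursive 3 (fun v => f (head 0 v) (head 0 (behead v))
                          (head 0 (behead (behead v)))) ->
  recursive n G -> recursive n H -> recursive n K ->
  recursive n (fun v => f (G v) (H v) (K v)).
Proof.
move=> rf rG rH rK; apply: (@recursive_comp n 3 _ [tuple G; H; K] rf).
by case=> [[|[|[|//]]] ?].
Qed.

Lemma recursive_S n G : recursive n G -> recursive n (fun v => (G v).+1).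
Proof.
apply: (@recursive_comp1 n S); exists RSucc => v y /=.
by rewrite /thead (tnth_nth 0) nth0; split=> ->.
Qed.

Lemma recursive_const n k : recursive n (fun=> k).
Proof.
elim: k => [|k]; last exact: recursive_S.
by apply: (@recursive_comp n 0 (fun=> 0) [tuple]) => [|[]//]; exists RZero.
Qed.

Definition shift_vars (k n : nat) : n.-tuple (seq nat -> nat) :=
  [tuple (fun v : seq nat => nth 0 v (k + i)) | i < n].

Lemma map_shift_vars k n (v : seq nat) : size v = k + n ->
  [seq g v | g <- shift_vars k n] = iter k behead v.
Proof.
have -> : iter k behead v = drop k v.
  by elim: k => [|k /= ->]; rewrite ?drop0 // -drop1 drop_drop.
move=> sv; apply: (@eq_from_nth _ 0) => [|i].
  by rewrite size_map size_tuple size_drop sv addKn.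
rewrite size_map size_tuple => lt_in.
rewrite (nth_map (fun=> 0)) ?size_tuple // nth_drop.
by rewrite -[i]/(nat_of_ord (Ordinal lt_in)) -tnth_nth tnth_mktuple.
Qed.

(** Composition in [recf] takes one function per argument, so the [n] untouched variables are
    supplied as projections. Weakening, swapping and let-binding of variables are instances. *)
Lemma recursive_subst j m n F (G : m.-tuple (seq nat -> nat)) :
  recursive (m + n) F -> (forall i, recursive (j + n) (tnth G i)) ->
  recursive (j + n) (fun v => F ([seq g v | g <- G] ++ iter j behead v)).
Proof.
move=> rF rG.
have rH i : recursive (j + n) (tnth [tuple of G ++ shift_vars j n] i).
  case: (split_ordP i) => k ->; first by rewrite tnth_lshift.
  by rewrite tnth_rshift tnth_mktuple; apply: recursive_nth; rewrite ltn_add2l.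
apply: recursive_ext (recursive_comp rF rH) => v.
by rewrite map_cat map_shift_vars ?size_tuple.
Qed.

Lemma recursive_behead n F :
  recursive n F -> recursive n.+1 (fun v => F (behead v)).
Proof. by move=> rF; apply: (@recursive_subst 1 0 n F [tuple]) => // -[]. Qed.

Lemma recursive_drop1 n F :
  recursive n.+1 F -> recursive n.+2 (fun v => F (head 0 v :: behead (behead v))).
Proof.
move=> rF; apply: (@recursive_subst 2 1 n F [tuple head 0]) => // i.
by rewrite (ord1 i); exact: recursive_var0.
Qed.

Lemma recursive_let n F H : recursive n.+1 F -> recursive n H ->
  recursive n (fun v => F (H v :: v)).
Proof.
move=> rF rH; apply: (@recursive_subst 0 1 n F [tuple H]) => // i.
by rewrite (ord1 i).
Qed.

Lemma recursive_prec n F G H : recursive n F ->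
  recursive n.+2 (fun w => G (head 0 w) (head 0 (behead w)) (behead (behead w))) ->
  recursive n H ->
  recursive n (fun v => nat_rec (fun=> nat) (F v) (fun k a => G k a v) (H v)).
Proof.
move=> [cF hF] [cG hG] rH.
pose P w := nat_rec (fun=> nat) (F (behead w))
  (fun k a => G k a (behead w)) (head 0 w).
suff : recursive n.+1 P by move/recursive_let => /(_ _ rH).
exists (RPrec cF cG) => v y /=.
rewrite /thead !(tnth_nth 0) nth0 /P.
set N := head 0 v; split.
  move=> [h [/hF h0 hS ->]].
  suff : forall k, k <= N -> nat_rec (fun=> nat) (F (behead v))
     (fun k a => G k a (behead v)) k = h k by apply.
  elim=> [//|k IH] lt_kN /=; rewrite IH; last exact: ltnW.
  by have /hG := hS k lt_kN.
move=> <-; exists (nat_rec (fun=> nat) (F (behead v))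
     (fun k a => G k a (behead v))); split=> [|k _|//]; first exact/hF.
by apply/hG.
Qed.

Lemma recursive_add n F G : recursive n F -> recursive n G ->
  recursive n (fun v => F v + G v).
Proof.
move=> rF rG.
have := @recursive_prec n F (fun _ a _ => a.+1) G rF
  (recursive_S (recursive_var1 n)) rG.
apply: recursive_ext => v; elim: (G v) => [|k /= ->]; first by rewrite addn0.
by rewrite addnS.
Qed.

Lemma recursive_pred n F : recursive n F -> recursive n (fun v => (F v).-1).
Proof.
move=> rF.
have := @recursive_prec n _ (fun k _ _ => k) F (recursive_const n 0)
  (recursive_var0 _) rF.
by apply: recursive_ext => v; case: (F v).
Qed.

Lemma recursive_sub n F G : recursive n F -> recursive n G ->
  recursive n (fun v => F v - G v).
Proof.
move=> rF rG.
have := @recursive_prec n F (fun _ a _ => a.-1) G rF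
  (recursive_pred (recursive_var1 n)) rG.
apply: recursive_ext => v; elim: (G v) => [|k /= ->]; first by rewrite subn0.
by rewrite subnS.
Qed.

Lemma recursive_sum n (F : nat -> seq nat -> nat) H :
  recursive n.+1 (fun w => F (head 0 w) (behead w)) -> recursive n H ->
  recursive n (fun v => \sum_(i < H v) F i v).
Proof.
move=> /recursive_drop1 rF rH.
have := @recursive_prec n _ (fun k a v => a + F k v) H (recursive_const n 0)
  (recursive_add (recursive_var1 _) rF) rH.
apply: recursive_ext => v; elim: (H v) => [|k /= ->]; first by rewrite big_ord0.
by rewrite big_ord_recr.
Qed.

Lemma recursive_mul n F G : recursive n F -> recursive n G ->
  recursive n (fun v => F v * G v).
Proof.
move=> rF rG.
have := @recursive_sum n (fun=> F) G (recursive_behead rF) rG.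
by apply: recursive_ext => v; rewrite sum_nat_const card_ord mulnC.
Qed.

Lemma recursive_prod n (F : nat -> seq nat -> nat) H :
  recursive n.+1 (fun w => F (head 0 w) (behead w)) -> recursive n H ->
  recursive n (fun v => \prod_(i < H v) F i v).
Proof.
move=> /recursive_drop1 rF rH.
have := @recursive_prec n _ (fun k a v => a * F k v) H (recursive_const n 1)
  (recursive_mul (recursive_var1 _) rF) rH.
apply: recursive_ext => v; elim: (H v) => [|k /= ->]; first by rewrite big_ord0.
by rewrite big_ord_recr.
Qed.

Lemma recursive_exp n F G : recursive n F -> recursive n G ->
  recursive n (fun v => F v ^ G v).
Proof.
move=> rF rG.
have := @recursive_prod n (fun=> F) G (recursive_behead rF) rG.
by apply: recursive_ext => v; rewrite prod_nat_const card_ord.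
Qed.

Lemma recursive_leq n F G : recursive n F -> recursive n G ->
  recursive n (fun v => nat_of_bool (F v <= G v)).
Proof.
move=> rF rG.
have := recursive_sub (recursive_const n 1) (recursive_sub rF rG).
by apply: recursive_ext => v; rewrite -subn_eq0; case: (F v - G v).
Qed.

Lemma recursive_and n (P Q : seq nat -> bool) : recursive n P -> recursive n Q ->
  recursive n (fun v => nat_of_bool (P v && Q v)).
Proof.
move=> rP rQ; have := recursive_mul rP rQ.
by apply: recursive_ext => v; rewrite mulnb.
Qed.

Lemma recursive_neg n (P : seq nat -> bool) : recursive n P ->
  recursive n (fun v => nat_of_bool (~~ P v)).
Proof.
move=> rP; have := recursive_sub (recursive_const n 1) rP.
by apply: recursive_ext => v; case: (P v).
Qed.

Lemma recursive_or n (P Q : seq nat -> bool) : recursive n P -> recursive n Q ->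
  recursive n (fun v => nat_of_bool (P v || Q v)).
Proof.
move=> rP rQ.
have := recursive_neg (recursive_and (recursive_neg rP) (recursive_neg rQ)).
by apply: recursive_ext => v; rewrite negb_and !negbK.
Qed.

Lemma recursive_eq n F G : recursive n F -> recursive n G ->
  recursive n (fun v => nat_of_bool (F v == G v)).
Proof.
move=> rF rG; have := recursive_and (recursive_leq rF rG) (recursive_leq rG rF).
by apply: recursive_ext => v; rewrite -eqn_leq.
Qed.

Lemma recursive_if n (P : seq nat -> bool) F G : recursive n P ->
  recursive n F -> recursive n G ->
  recursive n (fun v => if P v then F v else G v).
Proof.
move=> rP rF rG.
have := recursive_add (recursive_mul rP rF) (recursive_mul (recursive_neg rP) rG).
by apply: recursive_ext => v; case: (P v); rewrite !(mul0n, mul1n) ?addn0.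
Qed.

(** Writes a number as a bounded count of decidable tests; quotients, valuations, string lengths and
    complexities are computed in this form. *)
Lemma sum_ltn b a : a <= b -> \sum_(i < b) (i < a : nat) = a.
Proof.
move=> le_ab; rewrite (bigID (fun i : 'I_b => i < a)) /=.
rewrite [X in _ + X]big1 => [|i /negbTE->//]; rewrite addn0.
rewrite -(big_ord_widen_cond _ xpredT (fun i => (i < a : nat)) le_ab) /=.
rewrite (eq_bigr (fun=> 1)) => [|i _]; last by rewrite ltn_ord.
by rewrite sum_nat_const card_ord muln1.
Qed.

Lemma recursive_div n F G : recursive n F -> recursive n G ->
  recursive n (fun v => F v %/ G v).
Proof.
move=> rF rG.
have := @recursive_sum n
  (fun i v => nat_of_bool ((0 < G v) && (i.+1 * G v <= F v))) F.
move=> /(_ (recursive_and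
   (recursive_leq (recursive_const _ _) (recursive_behead rG))
   (recursive_leq (recursive_mul (recursive_S (recursive_var0 _))
       (recursive_behead rG)) (recursive_behead rF))) rF).
apply: recursive_ext => v; case: (posnP (G v)) => [->|G0].
  by rewrite divn0 big1.
rewrite -[RHS](sum_ltn (leq_div (F v) (G v))); apply: eq_bigr => i _.
by rewrite leq_divRL.
Qed.

Lemma recursive_dvd n F G : recursive n F -> recursive n G ->
  recursive n (fun v => nat_of_bool (F v %| G v)).
Proof.
move=> rF rG.
have := recursive_eq (recursive_mul (recursive_div rG rF) rF) rG.
by apply: recursive_ext => v; rewrite dvdn_eq.
Qed.

Lemma recursive_sum_nat n (F : nat -> seq nat -> nat) H :
  recursive n.+1 (fun w => F (head 0 w) (behead w)) -> recursive n H ->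
  recursive n (fun v => \sum_(0 <= i < H v) F i v).
Proof.
move=> rF rH; apply: recursive_ext (recursive_sum rF rH) => v.
by rewrite big_mkord.
Qed.

Lemma recursive_prod_nat n (F : nat -> seq nat -> nat) H :
  recursive n.+1 (fun w => F (head 0 w) (behead w)) -> recursive n H ->
  recursive n (fun v => \prod_(0 <= i < H v) F i v).
Proof.
move=> rF rH; apply: recursive_ext (recursive_prod rF rH) => v.
by rewrite big_mkord.
Qed.

Ltac recursive_tac :=
  repeat first
    [ assumption
    | exact: recursive_var0 | exact: recursive_var1 | exact: recursive_var2
    | exact: recursive_var3
    | exact: recursive_const
    | apply: recursive_S | apply: recursive_pred
    | apply: recursive_add | apply: recursive_sub
    | apply: recursive_mul | apply: recursive_exp | apply: recursive_div
    | apply: recursive_dvd | apply: recursive_eq | apply: recursive_leq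
    | apply: recursive_and | apply: recursive_or | apply: recursive_neg
    | apply: recursive_if
    | apply: recursive_sum_nat | apply: recursive_prod_nat ].

Lemma recursive_odd n F : recursive n F ->
  recursive n (fun v => nat_of_bool (odd (F v))).
Proof.
move=> rF; have : recursive n (fun v => nat_of_bool (~~ (2 %| F v))).
  by recursive_tac.
by apply: recursive_ext => v; rewrite dvdn2 negbK.
Qed.

Lemma recursive_logn n p F : prime p -> recursive n F ->
  recursive n (fun v => logn p (F v)).
Proof.
move=> pp rF.
have := @recursive_sum n
  (fun i v => nat_of_bool ((0 < F v) && (p ^ i.+1 %| F v))) F.
have rF' := recursive_behead rF.
have r1 : recursive n.+1 (fun w => nat_of_bool ((0 < F (behead w)) &&
  (p ^ (head 0 w).+1 %| F (behead w)))) by recursive_tac.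
move=> /(_ r1 rF); apply: recursive_ext => v.
case: (posnP (F v)) => [->|F0]; first by rewrite logn0 big1.
rewrite -[RHS](sum_ltn (ltnW (ltn_logl p F0))); apply: eq_bigr => i _.
by rewrite pfactor_dvdn.
Qed.

Lemma computable2P f : computable2 f <->
  recursive 2 (fun v => f (head 0 v) (head 0 (behead v))).
Proof.
split=> [[c hc]|[c hc]]; exists c.
  case=> [[|a [|b [|//]]] // sv] y /=; rewrite -hc.
  by rewrite (_ : Tuple sv = [tuple a; b]) //; apply: val_inj.
by move=> a b y; rewrite hc.
Qed.

(** * Stagewise evaluation *)

Lemma rec_eval_inj n (c : recf n) v y y' :
  rec_eval c v y -> rec_eval c v y' -> y = y'.
Proof.
elim: c v y y' => {n} [|| n i |m n f IHf g IHg|n f IHf g IHg|n f IHf] v y y' /=;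
  try by move=> -> ->.
- move=> [w [gw fw]] [w' [gw' fw']].
  suff ww' : w = w' by apply: IHf fw _; rewrite ww'.
  by apply: eq_from_tnth => i; apply: IHg (gw i) (gw' i).
- move=> [h [h0 hS ->]] [h' [h0' hS' ->]].
  suff : forall k, k <= thead v -> h k = h' k by apply.
  elim=> [_|k IH lt_kv]; first exact: IHf h0 h0'.
  apply: IHg (hS k lt_kv) _; rewrite IH ?(ltnW lt_kv) //; exact: hS'.
- move=> [fy ny] [fy' ny'].
  case: (ltngtP y y') => // [/ny'|/ny] [z] fz.
    by have := IHf _ _ _ fy fz.
  by have := IHf _ _ _ fy' fz.
Qed.

(** Finitely many stages have a maximum, and monotonicity carries every property up to it; this lets
    one clock serve several computations. *)
Lemma uniform_stage N (P : 'I_N -> nat -> Prop) :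
  (forall i t t', t <= t' -> P i t -> P i t') ->
  (forall i, exists t, P i t) -> exists t, forall i, P i t.
Proof.
move=> monoP /boolp.choice[f Pf]; exists (\max_i f i) => i.
exact: monoP (leq_bigmax i) (Pf i).
Qed.

(* The value [y.+1] of [T t v] means that the computation on [v] is found to
   halt with result [y] at stage [t], and the value [0] that it is still
   running. *)
Definition stage_function n (c : recf n) (T : nat -> seq nat -> nat) : Prop :=
  [/\ recursive n.+1 (fun w => T (head 0 w) (behead w)),
      forall (v : n.-tuple nat) t t' y, t <= t' -> T t v = y.+1 -> T t' v = y.+1
    & forall (v : n.-tuple nat) y, rec_eval c v y <-> exists t, T t v = y.+1].

Lemma stage_function_zero : stage_function RZero (fun _ _ => 1).
Proof.
split=> [|//|v y /=]; first exact: recursive_const.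
by split=> [->|[_ [->]]//]; exists 0.
Qed.

Lemma stage_function_succ : stage_function RSucc (fun _ v => (head 0 v).+2).
Proof.
split=> [|//|v y]; first by recursive_tac.
by rewrite /= /thead (tnth_nth 0) nth0; split=> [->|[_ [->]]//]; exists 0.
Qed.

Lemma stage_function_proj n (i : 'I_n) :
  stage_function (RProj i) (fun _ v => (nth 0 v i).+1).
Proof.
split=> [|//|v y].
  by apply/recursive_S/(@recursive_behead n (fun v => nth 0 v i))/recursive_nth.
by rewrite /= (tnth_nth 0); split=> [->|[_ [->]]//]; exists 0.
Qed.

(** The outer function is run only once all inner computations have halted, and with the same clock;
    the maximum of the individual stages is a stage at which the whole composite is seen to halt. *)
Lemma stage_function_comp m n (f : recf m) (g : 'I_m -> recf n) Tf Tg :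
  stage_function f Tf -> (forall i, stage_function (g i) (Tg i)) ->
  stage_function (RComp f g) (fun t v =>
    if all (fun i => 0 < Tg i t v) (enum 'I_m)
    then Tf t [tuple (Tg i t v).-1 | i < m] else 0).
Proof.
move=> [rf monof evf] Hg.
have allP' t v : reflect (forall i, 0 < Tg i t v)
    (all (fun i => 0 < Tg i t v) (enum 'I_m)).
  by apply: (iffP allP) => H i; [exact/H/mem_enum | move=> _].
split.
- apply: recursive_if; last exact: recursive_const.
    elim: (enum 'I_m) => [|i s IHs] /=; first exact: recursive_const.
    by apply: recursive_and IHs; case: (Hg i) => rg _ _; recursive_tac.
  pose G : m.+1.-tuple (seq nat -> nat) := [tuple of head 0 ::
    [tuple (fun w => (Tg i (head 0 w) (behead w)).-1) | i < m]].
  have rG i : recursive n.+1 (tnth G i).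
    case: (unliftP ord0 i) => [j|] ->; last exact: recursive_var0.
    rewrite tnthS tnth_mktuple; case: (Hg j) => rg _ _; exact: recursive_pred.
  apply: recursive_ext (recursive_comp rf rG) => w /=.
  by rewrite -map_comp.
- move=> v t t' y le_tt'; case: (allP' _ _) => // pos Tfy.
  have Eg i : Tg i t' v = Tg i t v.
    case: (Hg i) => _ monog _; rewrite -(prednK (pos i)).
    by apply: monog le_tt' _; rewrite prednK.
  have -> : [tuple (Tg i t' v).-1 | i < m] = [tuple (Tg i t v).-1 | i < m].
    by apply: eq_from_tnth => i; rewrite !tnth_mktuple Eg.
  by rewrite (introT (allP' _ _)) => [|i]; [exact: monof Tfy | rewrite Eg].
- move=> v y; split.
    move=> [w [gw /evf[t0 ft0]]].
    have [t Ht] : exists t, forall i, Tg i t v = (tnth w i).+1.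
      apply: uniform_stage => [i t t' le_tt'|i]; case: (Hg i) => _ monog evg.
        exact: monog le_tt'.
      exact/evg/gw.
    have Ht' i : Tg i (maxn t0 t) v = (tnth w i).+1.
      by case: (Hg i) => _ monog _; apply: monog (leq_maxr _ _) (Ht i).
    exists (maxn t0 t); rewrite (introT (allP' _ _)) => [|i]; last by rewrite Ht'.
    have -> : [tuple (Tg i (maxn t0 t) v).-1 | i < m] = w.
      by apply: eq_from_tnth => i; rewrite tnth_mktuple Ht'.
    exact: monof (leq_maxl _ _) ft0.
  move=> [t]; case: (allP' _ _) => // pos Tfy.
  exists [tuple (Tg i t v).-1 | i < m]; split=> [i|]; last by apply/evf; exists t.
  case: (Hg i) => _ _ evg; apply/evg; exists t.
  by rewrite tnth_mktuple prednK.
Qed.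

(** The value 0 of an unfinished step is absorbing, so a positive final value certifies that every
    step has halted. *)
Lemma stage_function_prec n (f : recf n) (g : recf n.+2) Tf Tg :
  stage_function f Tf -> stage_function g Tg ->
  stage_function (RPrec f g) (fun t v => nat_rec (fun=> nat) (Tf t (behead v))
    (fun k a => if a == 0 then 0 else Tg t (k :: a.-1 :: behead v)) (head 0 v)).
Proof.
move=> [rf monof evf] [rg monog evg].
set T := fun t v => nat_rec _ _ _ _.
pose S t v N := nat_rec (fun=> nat) (Tf t (behead v))
    (fun k a => if a == 0 then 0 else Tg t (k :: a.-1 :: behead v)) N.
have monoS (v : n.+1.-tuple nat) N t t' y : t <= t' ->
    S t v N = y.+1 -> S t' v N = y.+1.
  move=> le_tt'; elim: N y => [|N IH] y /=.
    by have := monof [tuple of behead v] t t' y le_tt'.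
  rewrite -!/(S _ _ _); case E: (S t v N) => [//|a]; rewrite (IH _ E) /=.
  by have := monog [tuple of N :: a :: behead v] t t' y le_tt'.
split.
- apply: (@recursive_prec n.+2 (fun w => Tf (head 0 w) (behead (behead w)))
    (fun k a w => if a == 0 then 0
       else Tg (head 0 w) (k :: a.-1 :: behead (behead w)))
    (fun w => head 0 (behead w))).
  + exact: (recursive_drop1 rf).
  + apply: recursive_if; [by recursive_tac | exact: recursive_const |].
    apply: (@recursive_subst 4 3 n _ [tuple (fun u => head 0 (behead (behead u)));
      head 0; (fun u => (head 0 (behead u)).-1)] rg).
    case=> [[|[|[|//]]] ?]; rewrite (tnth_nth (head 0)) /=.
    * exact: recursive_var2.
    * exact: recursive_var0.
    * by apply: recursive_pred; exact: recursive_var1.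
  + exact: recursive_var1.
- by move=> v t t' y; apply: monoS.
- move=> v y /=; rewrite /thead !(tnth_nth 0) nth0; set N := head 0 v; split.
    move=> [h [/evf[t0 ft0] hS ->]].
    have [t1 ht1] : exists t, forall k : 'I_N,
        Tg t [tuple of nat_of_ord k :: h k :: [tuple of behead v]] = (h k.+1).+1.
      apply: uniform_stage => [i t t' le_tt'|k]; first exact: monog.
      exact/evg/hS.
    exists (maxn t0 t1).
    suff : forall k, k <= N -> S (maxn t0 t1) v k = (h k).+1 by apply.
    elim=> [_|k IH lt_kN] /=.
      exact: (monof [tuple of behead v] _ _ _ (leq_maxl _ _) ft0).
    rewrite -/(S _ _ _) IH ?(ltnW lt_kN) //=.
    exact: (monog [tuple of k :: h k :: [tuple of behead v]] _ _ _
      (leq_maxr _ _) (ht1 (Ordinal lt_kN))).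
  move=> [t Ht].
  (* Downward induction from [N]: a zero at an earlier step would persist to the end. *)
  have pos k : k <= N -> 0 < S t v k.
    move=> le_kN; rewrite -(subKn le_kN); elim: (N - k) => [|d IH].
      by rewrite subn0 /S -/(T t v) Ht.
    case: (leqP N d) => [le_Nd|lt_dN].
      by move: IH; rewrite (eqP le_Nd) (eqP (leqW le_Nd)).
    move: IH; rewrite -(subnSK lt_dN) /= -/(S _ _ _).
    by case: (S t v (N - d.+1)).
  have SK k : k <= N -> S t v k = (S t v k).-1.+1.
    by move/pos/prednK.
  exists (fun k => (S t v k).-1); split=> [|k lt_kN|].
  + by apply/evf; exists t; rewrite prednK //; exact: (pos 0).
  + apply/evg; exists t; rewrite -SK //=.
    by rewrite -/(S _ _ _) (SK k (ltnW lt_kN)).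
  + by rewrite /S -/(T t v) Ht.
Qed.

(** A bounded search written as a sum. Stage value 1 encodes the result 0 and a larger value a
    nonzero result, so the term of [y] vanishes unless [y] is a zero of [f] and all smaller
    arguments are seen to give nonzero results. At most one term survives, and it equals [y.+1]. *)
Lemma stage_function_mu n (f : recf n.+1) Tf : stage_function f Tf ->
  stage_function (RMu f) (fun t v => \sum_(y < t) y.+1 *
    ((Tf t (nat_of_ord y :: v) == 1) *
     \prod_(k < y) (1 < Tf t (nat_of_ord k :: v)))).
Proof.
move=> [rf monof evf].
set T := fun t v => \sum_(y < t) _.
pose good t v y := Tf t (y :: v) = 1 /\ forall k, k < y -> 1 < Tf t (k :: v).
have goodT t v y : y < t -> good t v y -> T t v = y.+1.
  move=> lt_yt [fy fk]; rewrite /T (bigD1 (Ordinal lt_yt)) //= fy mul1n.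
  rewrite big1 => [|k _]; last by rewrite fk.
  rewrite muln1 big1 ?addn0 // => z /eqP neq_zy.
  case: (ltngtP z y) => [lt_zy|lt_yz|eq_zy].
  + by have := fk _ lt_zy; case: eqP => [->//|]; rewrite muln0.
  + by rewrite (bigD1 (Ordinal lt_yz)) //= fy !muln0.
  + by case: neq_zy; apply: val_inj.
have Tgood t v y : T t v = y.+1 -> y < t /\ good t v y.
  move=> Ty.
  have [z _ zP] : exists2 z : 'I_t, true & good t v z.
    apply: contrapT => noz; suff : T t v = 0 by rewrite Ty.
    apply: big1 => z _; case: eqP => fz; last by rewrite muln0.
    rewrite mul1n (_ : \prod_(k < z) _ = 0) ?muln0 //; apply: contrapT => /eqP.
    rewrite -lt0n => pos; apply: noz; exists z => //; split=> // k lt_kz.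
    move: pos; rewrite (bigD1 (Ordinal lt_kz)) //= muln_gt0 => /andP[].
    by case: (1 < _).
  by have := goodT _ _ _ (ltn_ord z) zP; rewrite Ty => -[->].
have mono_good (v : n.-tuple nat) t t' y : t <= t' -> good t v y -> good t' v y.
  move=> le_tt' [fy fk]; split.
    exact: (monof [tuple of y :: v] _ _ _ le_tt').
  move=> k /fk; case E: (Tf t (k :: v)) => [|[|a]] // _.
  by rewrite (monof [tuple of k :: v] _ _ _ le_tt' E).
split.
- apply: (@recursive_sum n.+1 (fun y w => y.+1 *
    ((Tf (head 0 w) (y :: behead w) == 1) *
     \prod_(k < y) (1 < Tf (head 0 w) (nat_of_ord k :: behead w)))) (head 0)).
    apply: recursive_mul; first by recursive_tac.
    apply: recursive_mul.
      apply: recursive_eq; last exact: recursive_const.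
      apply: (@recursive_subst 2 2 n _ [tuple (fun u => head 0 (behead u)); head 0] rf).
      by case=> [[|[|//]] ?]; rewrite (tnth_nth (head 0)) /=; recursive_tac.
    apply: (@recursive_prod n.+2 (fun k u =>
      1 < Tf (head 0 (behead u)) (k :: behead (behead u)))); last by recursive_tac.
    apply: recursive_leq; first exact: recursive_const.
    apply: (@recursive_subst 3 2 n _
      [tuple (fun u => head 0 (behead (behead u))); head 0] rf).
    by case=> [[|[|//]] ?]; rewrite (tnth_nth (head 0)) /=; recursive_tac.
  exact: recursive_var0.
- move=> v t t' y le_tt' /Tgood[lt_yt /(mono_good _ _ _ _ le_tt')].
  exact/goodT/(leq_trans lt_yt).
- move=> v y /=; split.
    move=> [/evf[t0 fy] fk].
    have [t1 ht1] : exists t, forall k : 'I_y, 1 < Tf t [tuple of nat_of_ord k :: v].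
      apply: uniform_stage => [k t t' le_tt'|k].
        case E: (Tf t [tuple of nat_of_ord k :: v]) => [|[|a]] // _.
        by rewrite (monof _ _ _ _ le_tt' E).
      by have [z /evf[t Ht]] := fk k (ltn_ord k); exists t; rewrite Ht.
    exists (maxn y.+1 (maxn t0 t1)); apply: goodT; first exact: leq_maxl.
    split.
      apply: (monof [tuple of y :: v] t0) => //.
      by rewrite !leq_max leqnn orbT.
    move=> k lt_ky; have := ht1 (Ordinal lt_ky).
    case E: (Tf _ _) => [|[|a]] // _.
    rewrite (monof [tuple of k :: v] t1 _ a.+1) //.
    by rewrite !leq_max leqnn !orbT.
  move=> [t /Tgood[_ [fy fk]]]; split; first by apply/evf; exists t.
  move=> k /fk; case E: (Tf t (k :: v)) => [|[|a]] // _.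
  by exists a; apply/evf; exists t.
Qed.

Lemma stage_function_exists n (c : recf n) : exists T, stage_function c T.
Proof.
elim: c => {n} [|| n i |m n f [Tf Hf] g IHg|n f [Tf Hf] g [Tg Hg]|n f [Tf Hf]].
- by eexists; exact: stage_function_zero.
- by eexists; exact: stage_function_succ.
- by eexists; exact: stage_function_proj.
- have [Tg Hg] := boolp.choice IHg.
  by eexists; exact: stage_function_comp Hf Hg.
- by eexists; exact: stage_function_prec Hf Hg.
- by eexists; exact: stage_function_mu Hf.
Qed.

(** * Binary strings *)

(** The most significant bit comes first, so that extending a string refines its dyadic interval;
    [string_code] reads the digits in the opposite order. *)
Fixpoint bits_val (p : seq bool) : nat :=
  if p is b :: p' then b * 2 ^ size p' + bits_val p' else 0.

Lemma bits_val_cat p q : bits_val (p ++ q) = bits_val p * 2 ^ size q + bits_val q.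
Proof.
by elim: p => [|b p IH] //=; rewrite IH size_cat expnD mulnDl mulnA addnA.
Qed.

Lemma bits_val_lt p : bits_val p < 2 ^ size p.
Proof. by elim: p => [|[] p IH] //=; rewrite expnS; lia. Qed.

Lemma bits_val_surj L V : V < 2 ^ L -> exists p, size p = L /\ bits_val p = V.
Proof.
elim: L V => [|L IH] V; first by rewrite ltnS leqn0 => /eqP->; exists [::].
rewrite expnS => ltV; case: (ltnP V (2 ^ L)) => [/IH[p [sp vp]]|leV].
  by exists (false :: p); rewrite /= sp vp.
have /IH[p [sp vp]] : V - 2 ^ L < 2 ^ L by lia.
by exists (true :: p); rewrite /= sp vp; split=> //; lia.
Qed.

(** In binary, [(string_code p).+1] is a leading 1 followed by the bits of [p] in reverse order, so
    its magnitude gives the length of [p]. *)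
Lemma string_code_bounds p :
  2 ^ size p <= (string_code p).+1 < 2 ^ (size p).+1.
Proof. by elim: p => [|b p IH] //=; rewrite !expnS in IH *; case: b => /=; lia. Qed.

Lemma string_code_lt p L : size p <= L -> (string_code p).+1 < 2 ^ L.+1.
Proof.
move=> le_pL; have /andP[_ lt_p] := string_code_bounds p.
by apply: leq_trans lt_p _; rewrite leq_exp2l.
Qed.

Definition code_size c := \sum_(0 <= j < c) (2 ^ j.+1 <= c.+1).

(** Bit [j] of [c.+1], counted from the least significant one, is bit [j] of the string counted from
    the left; the weights undo the reversal. *)
Definition code_val c :=
  \sum_(0 <= j < code_size c) odd (c.+1 %/ 2 ^ j) * 2 ^ (code_size c - j.+1).

Lemma code_sizeE p : code_size (string_code p) = size p.
Proof.
have /andP[le_p lt_p] := string_code_bounds p.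
have sp : size p <= string_code p.
  by rewrite -ltnS; apply: leq_trans le_p; exact: ltn_expl.
rewrite -[RHS](sum_ltn sp) /code_size big_mkord; apply: eq_bigr => j _; congr nat_of_bool.
apply/idP/idP => [le_j|lt_j].
  by rewrite -ltnS -(ltn_exp2l _ _ (isT : 1 < 2)); apply: leq_ltn_trans lt_p.
by apply: leq_trans le_p; rewrite leq_exp2l.
Qed.

Lemma code_valE p : code_val (string_code p) = bits_val p.
Proof.
rewrite /code_val code_sizeE big_mkord.
elim: p => [|b p IH] /=; first by rewrite big_ord0.
rewrite big_ord_recl /= expn0 divn1 subSS subn0 -IH; congr (_ * _ + _).
  by case: b; rewrite /= ?oddD ?odd_double.
apply: eq_bigr => j _; rewrite /bump /= add1n subSS expnS divnMA.
congr (nat_of_bool (odd (_ %/ _)) * _).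
by case: b => /=; lia.
Qed.

Lemma recursive_code_size n F : recursive n F ->
  recursive n (fun v => code_size (F v)).
Proof.
apply: (@recursive_comp1 n code_size); rewrite /code_size; recursive_tac.
Qed.

Lemma recursive_code_val n F : recursive n F ->
  recursive n (fun v => code_val (F v)).
Proof.
apply: (@recursive_comp1 n code_val); rewrite /code_val; apply: recursive_sum_nat.
  have ? : recursive 2 (fun w => code_size (head 0 (behead w))).
    by apply: recursive_code_size; recursive_tac.
  have ? : recursive 2 (fun w =>
      nat_of_bool (odd ((head 0 (behead w)).+1 %/ 2 ^ head 0 w))).
    by apply: recursive_odd; recursive_tac.
  by recursive_tac.
by apply: recursive_code_size; recursive_tac.
Qed.

(** * Decompressors *)

Lemma recf_decompressor (c : recf 1) : exists D,
  forall p y, rec_eval c [tuple string_code p] y <-> D p = Some y.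
Proof.
pose P p y := rec_eval c [tuple string_code p] y.
exists (fun p => if boolp.pselect (exists y, P p y) is left h
                 then Some (projT1 (boolp.cid h)) else None).
move=> p y; case: boolp.pselect => [h|noy].
  case: (boolp.cid h) => z Pz /=; split=> [Py|[<-]//].
  by rewrite (rec_eval_inj Pz Py).
by split=> // Py; case: noy; exists y.
Qed.

(** The shape of every decompressor constructed below: minimization over a recursive test on the
    code of the string, followed by a recursive output function. *)
Lemma search_decompressor (M : nat -> nat -> bool) (V : nat -> nat) :
  recursive 2 (fun v => M (head 0 v) (head 0 (behead v))) ->
  recursive 1 (fun v => V (head 0 v)) ->
  exists D, partial_computable D /\ forall p y, D p = Some y <->
    exists i, [/\ M i (string_code p),
      (forall j, j < i -> ~~ M j (string_code p)) & y = V i].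
Proof.
move=> /recursive_neg[cM hM] [cV hV].
have [D hD] := recf_decompressor (RComp cV (fun=> RMu cM)).
exists D; split; first by exists (RComp cV (fun=> RMu cM)).
move=> p y; rewrite -hD /=; split.
  move=> [w [/(_ ord0)[/hM /= Mw nM] /hV Vw]].
  exists (tnth w ord0); split=> [|j /nM[z /hM /=]|].
  - by move: Mw; case: (M _ _).
  - by case: (M _ _).
  - by rewrite -Vw (tnth_nth 0) nth0.
move=> [i [Mi nM ->]]; exists [tuple i]; split; last exact/hV.
move=> k; rewrite (ord1 k); split; first by apply/hM; rewrite /= Mi.
by move=> j /nM Mj; exists 0; apply/hM; rewrite /= Mj.
Qed.

Lemma partial_computable_stage D : partial_computable D ->
  exists T : nat -> nat -> nat,
  [/\ recursive 2 (fun v => T (head 0 v) (head 0 (behead v))),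
      forall t t' r y, t <= t' -> T t r = y.+1 -> T t' r = y.+1
    & forall p y, D p = Some y <-> exists t, T t (string_code p) = y.+1].
Proof.
move=> [c hc]; have [T [rT monoT evT]] := stage_function_exists c.
exists (fun t r => T t [:: r]); split.
- apply: recursive_ext rT; case=> [[|a [|b [|//]]] //].
- by move=> t t' r y; apply: (monoT [tuple r]).
- by move=> p y; rewrite -hc evT.
Qed.

Local Open Scope ring_scope.

(** * Kraft-Chaitin coding *)

(** The left end of the dyadic interval of [p], whose length is [2 ^- size p]. *)
Definition bin_frac (R : realFieldType) (p : seq bool) : R :=
  (bits_val p)%:R / 2 ^+ size p.

Lemma bin_frac_cat (R : realFieldType) p q :
  bin_frac R p <= bin_frac R (p ++ q) < bin_frac R p + 2 ^- size p.
Proof.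
have e0 k : 0 < (2 : R) ^+ k by exact: exprn_gt0.
have -> : bin_frac R (p ++ q) = bin_frac R p + bin_frac R q / 2 ^+ size p.
  rewrite /bin_frac bits_val_cat size_cat natrD natrM natrX exprD.
  by field; rewrite !lt0r_neq0.
have q0 : 0 <= bin_frac R q by rewrite divr_ge0 ?ler0n // ltW.
have q1 : bin_frac R q < 1.
  by rewrite ltr_pdivrMr // mul1r -natrX ltr_nat bits_val_lt.
rewrite lerDl divr_ge0 ?(ltW (e0 _)) //= ltrD2l.
by rewrite ltr_pdivrMr // mulVf ?lt0r_neq0.
Qed.

Lemma bin_frac_surj (R : realFieldType) L (a : R) : a + 2 * 2 ^- L <= 1 ->
  (exists V : nat, a <= V%:R / 2 ^+ L < a + 2 ^- L) ->
  exists p, size p = L /\ a <= bin_frac R p < a + 2 ^- L.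
Proof.
move=> a1 [V aV]; have e0 : 0 < (2 : R) ^+ L by exact: exprn_gt0.
suff /bits_val_surj[p [sp vp]] : (V < 2 ^ L)%N.
  by exists p; rewrite /bin_frac sp vp.
have i0 : 0 < (2 : R) ^- L by rewrite invr_gt0.
rewrite -(ltr_nat R) natrX -[ltRHS]mul1r -ltr_pdivrMr //.
by case/andP: aV => _ aV; lra.
Qed.

Lemma ceil_div (a d : nat) : (0 < d -> exists V, a <= V * d < a + d)%N.
Proof.
move=> d0; exists ((a + d.-1) %/ d)%N.
have := leq_trunc_div (a + d.-1) d; have := ltn_ceil (a + d.-1) d0.
by rewrite mulSn; lia.
Qed.

(* Request number [i] receives the interval [A i, A i.+1) of length [2 ^- l i],
   where [A i] is the sum of the previous lengths; one of its dyadic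
   subintervals of length [2 ^- (l i).+1] is the codeword. The search for the
   codeword compares integers: [A i] is [U i / 2 ^ P i]. *)
Lemma kraft_chaitin (R : realFieldType) (l v : nat -> nat) :
  recursive 1 (fun w => l (head 0%N w)) -> recursive 1 (fun w => v (head 0%N w)) ->
  (forall I, \sum_(0 <= i < I) (2 : R) ^- l i <= 1) ->
  exists D, [/\ partial_computable D, prefix_free D
    & forall i, exists p, D p = Some (v i) /\ size p = (l i).+1].
Proof.
move=> rl rv sum1.
pose A i : R := \sum_(0 <= j < i) 2 ^- l j.
(* A common exponent: it is at least each earlier length, so the truncated subtraction in [U] is
   exact. *)
pose P i := (\sum_(0 <= j < i) l j)%N.
pose U i := (\sum_(0 <= j < i) 2 ^ (P i - l j))%N.
have e0 k : 0 < (2 : R) ^+ k by exact: exprn_gt0.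
have UE i : (U i)%:R = A i * 2 ^+ P i.
  rewrite natr_sum mulr_suml; apply: eq_big_nat => j /andP[_ lt_ji].
  have le_lP : (l j <= P i)%N.
    by rewrite /P big_mkord (bigD1 (Ordinal lt_ji)) //= leq_addr.
  rewrite natrX -[in RHS](subnK le_lP) exprD; field; exact: lt0r_neq0.
have AS i : A i.+1 = A i + 2 ^- l i by rewrite /A big_nat_recr.
have A_mono i j : (i <= j)%N -> A i <= A j.
  move=> /subnK <-; elim: (j - i)%N => [//|k IH]; rewrite addSn AS.
  by apply: le_trans IH _; rewrite lerDl ltW // invr_gt0.
pose M i c := [&& code_size c == (l i).+1,
  (U i * 2 ^ (l i).+1 <= code_val c * 2 ^ P i)%N
  & (code_val c * 2 ^ P i < U i * 2 ^ (l i).+1 + 2 ^ P i)%N].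
have eqM i (V : nat) : ((U i * 2 ^ (l i).+1 <= V * 2 ^ P i)%N
    && (V * 2 ^ P i < U i * 2 ^ (l i).+1 + 2 ^ P i)%N)
    = (A i <= V%:R / 2 ^+ (l i).+1 < A i + 2 ^- (l i).+1).
  rewrite -(ler_nat R) -(ltr_nat R) natrD !natrM UE !natrX.
  rewrite -mulrAC ler_pM2r // ler_pdivlMr //; congr (_ && _).
  rewrite -[X in _ < _ + X]mul1r -mulrDl ltr_pM2r // ltr_pdivrMr //.
  by rewrite mulrDl mulVf ?lt0r_neq0.
have MP i p : M i (string_code p) = (size p == (l i).+1)
    && (A i <= bin_frac R p < A i + 2 ^- (l i).+1).
  rewrite /M code_sizeE code_valE; case: eqP => //= sp.
  by rewrite eqM /bin_frac sp.
(* The codeword starts less than [2 ^- (l i).+1] after [A i] and spans an interval of that same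
   length, so it stays inside the interval of its request together with all its extensions.
   Codewords of different requests are then incomparable. *)
have in_interval i p q : M i (string_code p) -> prefix p q ->
    A i <= bin_frac R q < A i.+1.
  rewrite MP AS => /andP[/eqP sp /andP[Ap pA]] /prefixP[r ->].
  have /andP[pr rp] := bin_frac_cat R p r.
  rewrite (le_trans Ap pr) /=; apply: (lt_le_trans rp).
  rewrite sp in rp *; have -> : (2 : R) ^- l i = 2 ^- (l i).+1 + 2 ^- (l i).+1.
    by rewrite exprS; field; exact: lt0r_neq0.
  by rewrite addrA lerD2r ltW.
have Minj i j p q : M i (string_code p) -> M j (string_code q) -> prefix p q ->
    i = j.
  move=> Mp Mq pq; have /andP[iq qi] := in_interval _ _ _ Mp pq.
  have /andP[jq qj] := in_interval _ _ _ Mq (prefix_refl q).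
  case: (ltngtP i j) => // /A_mono lt_A.
    by have := lt_le_trans qi (le_trans lt_A jq); rewrite ltxx.
  by have := lt_le_trans qj (le_trans lt_A iq); rewrite ltxx.
have rP : recursive 1 (fun w => P (head 0%N w)).
  apply: recursive_sum_nat; last exact: recursive_var0.
  by apply: (@recursive_comp1 _ l) => //; recursive_tac.
have rU : recursive 1 (fun w => U (head 0%N w)).
  apply: recursive_sum_nat; last exact: recursive_var0.
  apply: recursive_exp; first exact: recursive_const.
  by apply: recursive_sub; [apply: (@recursive_comp1 _ P) |
    apply: (@recursive_comp1 _ l)] => //; recursive_tac.
have [|D [cD hD]] := @search_decompressor M v _ rv.
  have rl' : recursive 2 (fun v => l (head 0%N v)).
    by apply: (@recursive_comp1 _ l) => //; recursive_tac.
  have rP' : recursive 2 (fun v => P (head 0%N v)).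
    by apply: (@recursive_comp1 _ P) => //; recursive_tac.
  have rU' : recursive 2 (fun v => U (head 0%N v)).
    by apply: (@recursive_comp1 _ U) => //; recursive_tac.
  have rs : recursive 2 (fun v => code_size (head 0%N (behead v))).
    by apply: recursive_code_size; recursive_tac.
  have rc : recursive 2 (fun v => code_val (head 0%N (behead v))).
    by apply: recursive_code_val; recursive_tac.
  by rewrite /M; recursive_tac.
exists D; split=> //.
  move=> p q; case Dp: (D p) => [y|//] _; case Dq: (D q) => [z|//] _ pq.
  have [i [Mp _ _]] := (hD p y).1 Dp; have [j [Mq _ _]] := (hD q z).1 Dq.
  have ij := Minj _ _ _ _ Mp Mq pq.
  move: Mp Mq pq; rewrite !MP -ij => /andP[/eqP sp _] /andP[/eqP sq _].
  move=> /prefixP[r rE]; move: sq; rewrite rE size_cat sp.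
  by case: r {rE} => [|b r]; rewrite ?cats0 //= addnS => /eqP; lia.
move=> i.
have [p [sp xp]] : exists p, size p = (l i).+1 /\
    A i <= bin_frac R p < A i + 2 ^- (l i).+1.
  apply: bin_frac_surj.
  - have -> : 2 * 2 ^- (l i).+1 = (2 : R) ^- l i.
      by rewrite exprS; field; exact: lt0r_neq0.
    by rewrite -AS; exact: sum1.
  have [|V hV] := @ceil_div (U i * 2 ^ (l i).+1)%N (2 ^ P i)%N.
    by rewrite expn_gt0.
  by exists V; rewrite -eqM.
have Mp : M i (string_code p) by rewrite MP sp eqxx.
exists p; split=> //; apply/hD; exists i; split=> // j lt_ji.
by apply/negP => /Minj /(_ Mp (prefix_refl p)) ji; rewrite ji ltnn in lt_ji.
Qed.

(** * Kraft's inequality *)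

(** Induction on the length bound. The empty string can only occur alone; otherwise the strings are
    split by their first bit, and removing it leaves two prefix-free families, each contributing at
    most [2 ^ L]. *)
Lemma kraft_nat L (s : seq (seq bool)) : uniq s ->
  {in s &, forall p q, prefix p q -> p = q} -> {in s, forall p, (size p <= L)%N} ->
  (\sum_(p <- s) 2 ^ (L - size p) <= 2 ^ L)%N.
Proof.
elim: L s => [|L IH] s us pf sz.
  rewrite (eq_big_seq (fun=> 1%N)) => [|p /sz]; last by rewrite leqn0 => /eqP->.
  rewrite sum1_size; case: s us pf sz => [|p [|q s]] //= /andP[pq _] _ sz.
  have s0 r : r \in [:: p, q & s] -> r = [::].
    by move/sz; rewrite leqn0 => /nilP.
  have p0 : p = [::] by apply: s0; rewrite inE eqxx.
  have q0 : q = [::] by apply: s0; rewrite !inE eqxx orbT.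
  by rewrite p0 q0 inE eqxx in pq.
case: (boolP ([::] \in s)) => [s0|ns0].
  have -> : s = [:: [::]].
    apply: perm_small_eq => //; apply: uniq_perm => // p; rewrite inE.
    apply/idP/eqP => [ps|->//]; apply/esym/pf => //; exact: prefix0s.
  by rewrite big_seq1 subn0.
pose t b := [seq behead p | p <- s & head false p == b].
have st b p : p \in t b -> b :: p \in s.
  case/mapP => -[|c q]; rewrite mem_filter => /andP[/eqP <- qs] -> //=.
  by rewrite qs in ns0.
have ut b : uniq (t b).
  rewrite map_inj_in_uniq ?filter_uniq // => -[|c p] [|d q] //=;
    rewrite !mem_filter /= ?(negbTE ns0) ?andbF //.
  by move=> /andP[/eqP-> _] /andP[/eqP-> _] ->.
have Hb b : (\sum_(p <- s | head false p == b) 2 ^ (L.+1 - size p) <= 2 ^ L)%N.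
  rewrite -big_filter.
  have -> : (\sum_(p <- [seq p <- s | head false p == b]) 2 ^ (L.+1 - size p)
     = \sum_(p <- t b) 2 ^ (L - size p))%N.
    rewrite big_map; apply: eq_big_seq => -[|c p]; rewrite mem_filter //=.
    by rewrite (negbTE ns0) andbF.
  apply: IH => [//|p q /st ps /st qs pq|p /st/sz //].
  have bpq : prefix (b :: p) (b :: q) by rewrite /= eqxx.
  by case: (pf _ _ ps qs bpq).
rewrite (bigID (fun p => head false p == true)) /= expnS mul2n -addnn leq_add //.
rewrite (eq_bigl (fun p => head false p == false)) // => p.
by case: (head _ _).
Qed.

(** * Complexity and busy beavers *)

Local Open Scope classical_set_scope.

Lemma nat_minP (A : set nat) n : A n -> A (nat_min A) /\ (nat_min A <= n)%N.
Proof.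
move=> An.
have exA : exists k, `[< A k >] by exists n; exact/asboolP.
have [k /asboolP Ak kmin] := ex_minnP exA.
have [Am lbm] : (A `&` lbound A) (nat_min A).
  by apply: xgetPex; exists k; split=> // j Aj; apply/kmin/asboolP.
by split=> //; exact: lbm.
Qed.

Lemma nat_max_ge (A : set nat) b n : (forall k, A k -> (k <= b)%N) ->
  A n -> (n <= nat_max A)%N.
Proof.
move=> Ab An.
have exA : exists k, `[< A k >] by exists n; exact/asboolP.
have bA k : `[< A k >] -> (k <= b)%N by move/asboolP/Ab.
have [k /asboolP Ak kmax] := ex_maxnP exA bA.
have [_ ubm] : (A `&` ubound A) (nat_max A).
  by apply: xgetPex; exists k; split=> // j Aj; apply/kmax/asboolP.
exact: ubm.
Qed.

Lemma nat_max_mem (A : set nat) : nat_max A = 0%N \/ A (nat_max A).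
Proof. by rewrite /nat_max; case: xgetP => [x -> [Ax _]|_]; [right|left]. Qed.

Lemma complexity_le D p N : D p = Some N -> (complexity D N <= size p)%N.
Proof. by move=> Dp; apply: (nat_minP _).2; exists p. Qed.

Lemma complexity_witness D p N : D p = Some N ->
  exists q, D q = Some N /\ size q = complexity D N.
Proof.
move=> Dp.
have [|[q Dq sq] _] :=
  @nat_minP [set size p | p in [set p | D p = Some N]] (size p).
  by exists p.
by exists q.
Qed.

(** There are finitely many strings of length at most [L], so the set that defines the busy beaver
    is bounded and its maximum exists. The induction absorbs the first bit into the decompressor. *)
Lemma bounded_outputs (D : seq bool -> option nat) L : exists b, forall p N,
  (size p <= L)%N -> D p = Some N -> (N <= b)%N.
Proof.
elim: L D => [|L IH] D.
  exists (odflt 0%N (D [::])) => p N; rewrite leqn0 => /nilP -> ->; exact: leqnn.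
have [b0 h0] := IH (fun p => D (false :: p)).
have [b1 h1] := IH (fun p => D (true :: p)).
exists (maxn (odflt 0%N (D [::])) (maxn b0 b1)) => -[|b p] N.
  by move=> _ ->; exact: leq_maxl.
rewrite /= ltnS => sp Dp; rewrite !leq_max.
by case: b Dp => [/(h1 _ _ sp)->|/(h0 _ _ sp)->]; rewrite !orbT.
Qed.

Lemma busy_beaver_ge D n N : (forall k, exists p, D p = Some k) ->
  (complexity D N <= n)%N -> (N <= busy_beaver D n)%N.
Proof.
move=> surjD cN; have [b hb] := bounded_outputs D n.
apply: (@nat_max_ge _ b) => // k /= ck.
have [p Dp] := surjD k; have [q [Dq sq]] := complexity_witness Dp.
by apply: hb Dq; rewrite sq.
Qed.

(** The value 0 accounts for the default on the empty set. It is harmless, since every use bounds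
    the busy beaver from above. *)
Lemma busy_beaver_witness D n : (forall k, exists p, D p = Some k) ->
  busy_beaver D n = 0%N \/
  exists p, D p = Some (busy_beaver D n) /\ (size p <= n)%N.
Proof.
move=> surjD; have [E|cN] := nat_max_mem [set N | (complexity D N <= n)%N].
  by left.
have [p Dp] := surjD (busy_beaver D n); have [q [Dq sq]] := complexity_witness Dp.
by right; exists q; rewrite sq.
Qed.

Lemma sum_half_powers (R : realFieldType) I :
  \sum_(0 <= i < I) (2 : R) ^- i.+1 = 1 - 2 ^- I.
Proof.
elim: I => [|I IH]; first by rewrite big_nil expr0 invr1 subrr.
rewrite big_nat_recr //= IH exprS; field; exact/lt0r_neq0/exprn_gt0.
Qed.

(** Lengths [N.+1] have total cost below 1, and Kraft-Chaitin coding adds one bit. Comparison with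
    this decompressor shows that every number has a description and that its prefix complexity is at
    most linear. *)
Lemma unary_decompressor : exists D, [/\ partial_computable D, prefix_free D
  & forall N, exists p, D p = Some N /\ size p = N.+2].
Proof.
apply: (@kraft_chaitin rat S id); [by recursive_tac | exact: recursive_var0 |].
move=> I; rewrite sum_half_powers gerBl invr_ge0; exact: exprn_ge0.
Qed.

Lemma optimal_surjective D : optimal_decompressor D ->
  forall N, exists p, D p = Some N.
Proof.
move=> [_ opt] N; have [D' [cD' _ D'N]] := unary_decompressor.
have [p' [D'p' _]] := D'N N; have [c hc] := opt _ cD'.
by have [p [Dp _]] := hc _ _ D'p'; exists p.
Qed.

Lemma optimal_prefix_free_linear D : optimal_prefix_free_decompressor D ->
  exists c, forall N, exists p, D p = Some N /\ (size p <= N + c)%N.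
Proof.
move=> [_ _ opt]; have [D' [cD' pD' D'N]] := unary_decompressor.
have [c hc] := opt _ cD' pD'; exists c.+2 => N.
have [p' [D'p' sp']] := D'N N; have [p [Dp sp]] := hc _ _ D'p'.
by exists p; split=> //; lia.
Qed.

Lemma optimal_prefix_free_surjective D : optimal_prefix_free_decompressor D ->
  forall N, exists p, D p = Some N.
Proof.
by move=> /optimal_prefix_free_linear[c hc] N; have [p [Dp _]] := hc N; exists p.
Qed.

Lemma string_code_surj r : exists p, string_code p = r.
Proof.
elim/ltn_ind: r => -[|r] IH; first by exists [::].
have [|p hp] := IH r./2; first by lia.
by exists (odd r :: p); rewrite /= hp odd_double_half.
Qed.

Lemma cvg_natP (u : nat -> nat) (a : nat) :
  u k @[k --> \oo] --> a <-> exists K, forall k, (K <= k)%N -> u k = a.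
Proof.
split=> [ua|[K hK]]; last first.
  by apply: cvg_near_cst; exists K => // k /= /hK.
have : nbhs a [set a] by rewrite nbhs_principalE; exact/principal_filterP.
by move=> /ua[K _ hK]; exists K => k /hK.
Qed.

(* The complexity is the number of lengths [L] such that no program of length
   at most [L] produces [n]; a linear bound on it makes this a finite count. *)
Lemma complexity_upper_semicomputable D c : partial_computable D ->
  (forall N, exists p, D p = Some N /\ (size p <= N + c)%N) ->
  upper_semicomputable_nat (complexity D).
Proof.
move=> cD lin; have [T [rT monoT evT]] := partial_computable_stage cD.
(* Some program with code below [t] and length at most [L] is seen by stage [t] to output [n]. *)
pose F n t L := (0 < \sum_(0 <= r < t) ((code_size r <= L) && (T t r == n.+1)))%N.
have FP n t L : reflect (exists r, [/\ (r < t)%N, (code_size r <= L)%N & T t r = n.+1])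
    (F n t L).
  rewrite /F lt0n sum_nat_seq_neq0; apply: (iffP hasP) => [[r]|[r [rt rL Tr]]].
    by rewrite mem_index_iota /= => rt; case: andP => // -[rL /eqP Tr]; exists r.
  by exists r; rewrite ?mem_index_iota // rL Tr eqxx.
exists (fun n t => (\sum_(0 <= L < n + c) ~~ F n t L)%N); split.
- apply/computable2P; rewrite /F.
  apply: recursive_sum_nat; last by recursive_tac.
  apply: recursive_neg; apply: recursive_leq; first exact: recursive_const.
  apply: recursive_sum_nat; last by recursive_tac.
  apply: recursive_and.
    by apply: recursive_leq; [apply: recursive_code_size|]; recursive_tac.
  by apply: recursive_eq; [apply: (@recursive_comp2 _ T) => //|]; recursive_tac.
- move=> n t t'; rewrite !leEnat => le_tt'; apply: leq_sum => L _.
  have : F n t L -> F n t' L.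
    case/FP=> r [rt rL Tr]; apply/FP; exists r.
    by split=> //; [exact: leq_trans le_tt' | exact: monoT Tr].
  by case: (F n t L) => [->|]; case: (F n t' L).
- move=> n; apply/cvg_natP.
  have [p0 [Dp0 sp0]] := lin n; have [p [Dp sp]] := complexity_witness Dp0.
  have [t0 Tp] := (evT p n).1 Dp.
  have leK : (complexity D n <= n + c)%N.
    exact: leq_trans (complexity_le Dp0) sp0.
  (* From this stage on, a shortest program of [n] is within the searched range and seen to halt. *)
  exists (maxn t0 (string_code p).+1) => t; rewrite geq_max => /andP[t0t pt].
  rewrite -[RHS](sum_ltn leK) big_mkord; apply: eq_bigr => L _.
  congr nat_of_bool; rewrite ltnNge; congr (~~ _); apply/FP/idP.
    move=> [r [_ rL Tr]]; have [q rE] := string_code_surj r.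
    rewrite -rE code_sizeE in rL Tr.
    by apply: leq_trans rL; apply: complexity_le; apply/evT; exists t.
  move=> KL; exists (string_code p); split=> //; first by rewrite code_sizeE sp.
  exact: monoT Tp.
Qed.

(** Shortest programs of different numbers are distinct, and none is a prefix of another.
    Multiplying by [2 ^ L], for a common bound [L] on the lengths, gives the integer inequality. *)
Lemma kraft_inequality (R : realType) D : prefix_free D ->
  (forall N, exists p, D p = Some N) ->
  forall I, \sum_(0 <= n < I) (2 : R) ^- complexity D n <= 1.
Proof.
move=> pf surjD I.
have /boolp.choice[f hf] N : exists p, D p = Some N /\ size p = complexity D N.
  by have [p Dp] := surjD N; exact: complexity_witness Dp.
pose L := (\max_(n < I) size (f n))%N.
have szL n : (n < I)%N -> (size (f n) <= L)%N.
  by move=> lt_nI; exact: (leq_bigmax (Ordinal lt_nI)).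
have finj : injective f.
  by move=> i j fij; have := (hf i).1; rewrite fij (hf j).1 => -[].
have := @kraft_nat L [seq f n | n <- iota 0 I].
rewrite map_inj_uniq ?iota_uniq // => /(_ isT).
have e0 : 0 < (2 : R) ^+ L by exact: exprn_gt0.
rewrite big_map -(ler_nat R) natr_sum natrX => kraft.
rewrite -(ler_pM2r e0) mul1r mulr_suml; apply: le_trans (kraft _ _); last first.
- by move=> p /mapP[i]; rewrite mem_iota add0n => /szL ? ->.
- by move=> p q /mapP[i _ ->] /mapP[j _ ->]; apply: pf; rewrite (hf _).1.
rewrite /index_iota subn0 le_eqVlt; apply/orP; left; apply/eqP.
apply: eq_big_seq => n; rewrite mem_iota add0n => /szL leL.
rewrite natrX -(hf n).2 -[in LHS](subnK leL) exprD.
by field; exact/lt0r_neq0/exprn_gt0.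
Qed.

(** Lengthening every request by [C] bits brings the total cost below 1. These bits, the bit lost in
    Kraft-Chaitin coding and the constant of optimality make up [c]. *)
Lemma optimal_prefix_free_requests (R : realFieldType) D (l v : nat -> nat) C :
  optimal_prefix_free_decompressor D ->
  recursive 1 (fun w => l (head 0%N w)) -> recursive 1 (fun w => v (head 0%N w)) ->
  (forall I, \sum_(0 <= i < I) (2 : R) ^- l i <= 2 ^+ C) ->
  exists c, forall i, exists p, D p = Some (v i) /\ (size p <= l i + c)%N.
Proof.
move=> [_ _ opt] rl rv sumC.
have e0 : 0 < (2 : R) ^+ C by exact: exprn_gt0.
have [||I|D' [cD' pD' D'v]] := @kraft_chaitin R (fun i => l i + C)%N v.
- by recursive_tac.
- by [].
- rewrite -(ler_pM2r e0) mul1r; apply: le_trans (sumC I).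
  rewrite mulr_suml; apply: ler_sum => i _.
  by rewrite exprD invfM mulfVK ?lt0r_neq0.
have [c hc] := opt _ cD' pD'; exists (C + c).+1 => i.
have [p' [D'p' sp']] := D'v i; have [p [Dp sp]] := hc _ _ D'p'.
by exists p; split=> //; lia.
Qed.

(** * Requests indexed by triples, and the bound of B by BP *)

Definition triple_code (n r t : nat) : nat := (2 ^ n * 3 ^ r * 5 ^ t)%N.

Lemma triple_codeK n r t : [/\ logn 2 (triple_code n r t) = n,
  logn 3 (triple_code n r t) = r & logn 5 (triple_code n r t) = t].
Proof.
by rewrite /triple_code; split; rewrite !lognM ?muln_gt0 ?expn_gt0 // !lognX
  !logn_prime //= !(muln0, muln1, addn0, add0n).
Qed.

(** False for 0 and for numbers with a prime factor other than 2, 3 and 5; such indices carry only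
    fillers. *)
Definition is_triple_code i := i == triple_code (logn 2 i) (logn 3 i) (logn 5 i).

(** The exponents in [i] are smaller than the bound and determine a coded triple, so the sum over
    codes is part of the nonnegative sum over the whole cube. *)
Lemma sum_triple_code (R : realFieldType) (W : nat -> nat -> nat -> R) I :
  (forall n r t, 0 <= W n r t) ->
  \sum_(i < I | is_triple_code i) W (logn 2 i) (logn 3 i) (logn 5 i) <=
  \sum_(n < I) \sum_(r < I) \sum_(t < I) W n r t.
Proof.
case: I => [|I] W0; first by rewrite !big_ord0.
have log_lt p (i : 'I_I.+1) : (logn p i < I.+1)%N.
  case: (posnP i) => [->|i0]; first by rewrite logn0.
  exact: ltn_trans (ltn_logl p i0) (ltn_ord i).
pose h (i : 'I_I.+1) : 'I_I.+1 * ('I_I.+1 * 'I_I.+1) :=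
  (inord (logn 2 i), (inord (logn 3 i), inord (logn 5 i))).
pose G (x : 'I_I.+1 * ('I_I.+1 * 'I_I.+1)) := W x.1 x.2.1 x.2.2.
pose S := [set i : 'I_I.+1 | is_triple_code i]%SET.
have hinj : {in S &, injective h}.
  move=> i j; rewrite !inE => /eqP Ei /eqP Ej [].
  move=> /(congr1 val) /=; rewrite !inordK // => E2.
  move=> /(congr1 val) /=; rewrite !inordK // => E3.
  move=> /(congr1 val) /=; rewrite !inordK // => E5.
  by apply: val_inj; rewrite /= Ei Ej E2 E3 E5.
have -> : \sum_(n < I.+1) \sum_(r < I.+1) \sum_(t < I.+1) W n r t = \sum_x G x.
  under eq_bigr do rewrite pair_bigA.
  by rewrite pair_bigA.
have -> : \sum_(i < I.+1 | is_triple_code i) W (logn 2 i) (logn 3 i) (logn 5 i)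
    = \sum_(x in h @: S) G x.
  rewrite big_imset //=; apply: eq_big => [i|i _]; first by rewrite inE.
  by rewrite /G /= !inordK.
rewrite [leRHS](bigID (mem (h @: S))) /= lerDl; apply: sumr_ge0 => x _; exact: W0.
Qed.

Lemma sum_ltn_le I a : (\sum_(i < I) (i < a : nat) <= a)%N.
Proof.
case: (leqP a I) => [/sum_ltn->//|/ltnW le_Ia]; apply: leq_trans le_Ia.
rewrite -[leqRHS]card_ord -sum1_card; apply: leq_sum => i _.
by case: (_ < _)%N.
Qed.

Lemma nondecreasing_cvg_nat_le (u : nat -> nat) a : nondecreasing_seq u ->
  u k @[k --> \oo] --> a -> forall t, (u t <= a)%N.
Proof.
move=> mono /cvg_natP[K hK] t; rewrite -(hK (maxn K t)) ?leq_maxl //.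
exact/mono/leq_maxr.
Qed.

Lemma nonincreasing_cvg_nat_ge (u : nat -> nat) a : nonincreasing_seq u ->
  u k @[k --> \oo] --> a -> forall t, (a <= u t)%N.
Proof.
move=> mono /cvg_natP[K hK] t; rewrite -(hK (maxn K t)) ?leq_maxl //.
exact/mono/leq_maxr.
Qed.

Lemma ler_half_powers (R : realFieldType) i j : (i <= j)%N ->
  (2 : R) ^- j <= 2 ^- i.
Proof.
by move=> le_ij; rewrite lef_pV2 ?posrE ?exprn_gt0 // ler_weXn2l // ler1n.
Qed.

(* A request is issued at each stage where [c] holds for the first time or
   where the length [u] drops, so that the costs form a geometric series. *)
Definition fresh (c : nat -> bool) (u : nat -> nat) t :=
  c t && [|| t == 0, ~~ c t.-1 | u t < u t.-1]%N.

(** The invariant is that the cost so far is at most twice the current one. When the length drops,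
    twice the old cost is at most the new cost, so adding the new request restores the invariant.
    The factor [c I] records that nothing is spent before [c] holds. *)
Lemma sum_fresh (R : realFieldType) (c : nat -> bool) (u : nat -> nat) I :
  (forall t, c t -> c t.+1) -> (forall t, (u t.+1 <= u t)%N) ->
  \sum_(t < I.+1) (fresh c u t)%:R * (2 : R) ^- u t <= (c I)%:R * (2 * 2 ^- u I).
Proof.
move=> monoc monou; have e0 k : 0 < (2 : R) ^- k by rewrite invr_gt0 exprn_gt0.
elim: I => [|I IH].
  rewrite big_ord_recl big_ord0 addr0 /fresh eqxx andbT.
  by rewrite ler_wpM2l ?ler0n //; have := e0 (u 0); lra.
rewrite big_ord_recr /=; apply: le_trans (lerD IH (lexx _)) _.
rewrite /fresh /=; have := monoc I; have := monou I.
case: (c I.+1) => [|le_u cI]; last first.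
  by case: (c I) cI => [/(_ isT)//|_]; rewrite !mul0r addr0.
rewrite leq_eqVlt => /orP[/eqP-> _|lt_u _].
  by rewrite ltnn orbF; case: (c I); rewrite /= !(mul0r, mul1r, addr0, add0r) //;
     have := e0 (u I); lra.
rewrite lt_u orbT !mul1r.
have : (2 : R) * 2 ^- u I <= 2 ^- u I.+1.
  have -> : (2 : R) ^- u I.+1 = 2 * 2 ^- (u I.+1).+1.
    by rewrite exprS; field; rewrite lt0r_neq0 ?exprn_gt0.
  by rewrite ler_pM2l // ler_half_powers.
by case: (c I); rewrite ?mul0r ?mul1r; have := e0 (u I.+1); lra.
Qed.

(** The cost hypothesis bounds partial sums, a form that Kraft's inequality provides for (ii) and
    convergence of the series for (iii). *)
Lemma busy_beaver_le_prefix (R : realFieldType) D Dp (x y : nat -> nat) C :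
  partial_computable D -> (forall N, exists p, D p = Some N) ->
  optimal_prefix_free_decompressor Dp ->
  lower_semicomputable_nat x -> upper_semicomputable_nat y ->
  (forall I, \sum_(n < I) (2 : R) ^+ x n / 2 ^+ y n <= 2 ^+ C) ->
  exists c, forall n, (busy_beaver D (x n) <= busy_beaver Dp (y n + c))%N.
Proof.
move=> cD surjD optDp [X [/computable2P rX monoX limX]].
move=> [Y [/computable2P rY monoY limY]] sumC.
have [T [rT monoT evT]] := partial_computable_stage cD.
have e0 k : 0 < (2 : R) ^+ k by exact: exprn_gt0.
have leX n t : (X n t <= x n)%N := nondecreasing_cvg_nat_le (monoX n) (limX n) t.
have geY n t : (y n <= Y n t)%N := nonincreasing_cvg_nat_ge (monoY n) (limY n) t.
(* The inequality says that the string with code [r] has length at most [X n t]. *)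
pose cond n r t := (r.+1 < 2 ^ (X n t).+1)%N && (0 < T t r)%N.
have cond_mono n r t t' : (t <= t')%N -> cond n r t -> cond n r t'.
  move=> le_tt' /andP[rX' Tt]; rewrite /cond.
  have XX : (X n t <= X n t')%N by exact: monoX.
  rewrite (leq_trans rX') ?leq_exp2l ?ltnS //=.
  case E: (T t r) Tt => [//|z] _; by rewrite (monoT _ _ _ _ le_tt' E).
pose new n r t := fresh (cond n r) (Y n) t.
pose real i := is_triple_code i && new (logn 2 i) (logn 3 i) (logn 5 i).
pose l i := if real i then Y (logn 2 i) (logn 5 i) else i.+1.
pose v i := (T (logn 5 i) (logn 3 i)).-1.
pose W n r t : R := (new n r t)%:R * 2 ^- Y n t.
have W0 n r t : 0 <= W n r t by rewrite mulr_ge0 ?ler0n // invr_ge0 ltW.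
have sumW n r I : \sum_(t < I) W n r t <=
    (r < 2 ^ (x n).+1)%N%:R * (2 * 2 ^- y n).
  case: I => [|I].
    by rewrite big_ord0 !mulr_ge0 ?ler0n // invr_ge0 ltW.
  apply: le_trans (sum_fresh R I (fun t => cond_mono n r t t.+1 (leqnSn t)) _) _.
    by move=> t; exact: monoY.
  apply: ler_pM; rewrite ?ler0n ?mulr_ge0 ?invr_ge0 ?(ltW (e0 _)) //.
    rewrite ler_nat; case E: (cond n r I) => //; case/andP: E => E _.
    by rewrite (leq_trans (ltnW E)) // leq_exp2l // ltnS leX.
  by rewrite ler_pM2l // ler_half_powers.
have sumWr n I : \sum_(r < I) \sum_(t < I) W n r t <= 4 * (2 ^+ x n / 2 ^+ y n).
  apply: le_trans; first by apply: ler_sum => r _; exact: sumW.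
  rewrite -mulr_suml -natr_sum.
  have := sum_ltn_le I (2 ^ (x n).+1); rewrite -(ler_nat R) natrX => le1.
  apply: le_trans (ler_wpM2r _ le1) _; first by rewrite mulr_ge0 ?invr_ge0 // ltW.
  by rewrite exprS le_eqVlt; apply/orP; left; apply/eqP; ring.
have sumWn I : \sum_(n < I) \sum_(r < I) \sum_(t < I) W n r t <= 4 * 2 ^+ C.
  apply: le_trans; first by apply: ler_sum => n _; exact: sumWr.
  by rewrite -mulr_sumr ler_pM2l.
(* Genuine requests cost at most [4 * 2 ^+ C] and fillers at most 1, which [2 ^+ C.+3] dominates. *)
have suml I : \sum_(0 <= i < I) (2 : R) ^- l i <= 2 ^+ C.+3.
  have e1 : 1 <= (2 : R) ^+ C by rewrite exprn_ege1 // ler1n.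
  apply: (@le_trans _ _ (4 * 2 ^+ C + 1)); last by rewrite !exprS; lra.
  apply: le_trans (_ : \sum_(0 <= i < I) ((real i)%:R * 2 ^- Y (logn 2 i) (logn 5 i)
       + 2 ^- i.+1) <= _).
    apply: ler_sum => i _; rewrite /l; case: (real i); rewrite ?mul1r ?mul0r ?add0r //.
    by rewrite lerDl invr_ge0 ltW.
  rewrite big_split /= sum_half_powers; apply: lerD; last first.
    by rewrite gerBl invr_ge0 ltW.
  apply: le_trans (sumWn I); apply: le_trans (sum_triple_code I W0).
  rewrite big_mkord [leRHS]big_mkcond /=; apply: ler_sum => i _.
  by rewrite /real; case: is_triple_code; rewrite /= ?mul0r.
have r2 : recursive 1 (fun w => logn 2 (head 0%N w)).
  by apply: recursive_logn => //; exact: recursive_var0.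
have r3 : recursive 1 (fun w => logn 3 (head 0%N w)).
  by apply: recursive_logn => //; exact: recursive_var0.
have r5 : recursive 1 (fun w => logn 5 (head 0%N w)).
  by apply: recursive_logn => //; exact: recursive_var0.
have rv : recursive 1 (fun w => v (head 0%N w)).
  by apply: recursive_pred; apply: (@recursive_comp2 _ T).
have rY' : recursive 1 (fun w => Y (logn 2 (head 0%N w)) (logn 5 (head 0%N w))).
  exact: (@recursive_comp2 _ Y).
have rl : recursive 1 (fun w => l (head 0%N w)).
  have rt : recursive 1 (fun w => (logn 5 (head 0%N w)).-1) by recursive_tac.
  have rc : recursive 3 (fun w => cond (head 0%N w) (head 0%N (behead w))
      (head 0%N (behead (behead w)))).
    have : recursive 3 (fun w => X (head 0%N w) (head 0%N (behead (behead w)))).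
      by apply: (@recursive_comp2 _ X) => //; recursive_tac.
    have : recursive 3 (fun w => T (head 0%N (behead (behead w))) (head 0%N (behead w))).
      by apply: (@recursive_comp2 _ T) => //; recursive_tac.
    by move=> ? ?; rewrite /cond; recursive_tac.
  have rc1 := @recursive_comp3 1 (fun n r t => cond n r t) _ _ _ rc r2 r3 r5.
  have rc2 := @recursive_comp3 1 (fun n r t => cond n r t) _ _ _ rc r2 r3 rt.
  have rY2 := @recursive_comp2 1 Y _ _ rY r2 rt.
  by rewrite /l /real /new /fresh /is_triple_code /triple_code; recursive_tac.
have [c hc] := optimal_prefix_free_requests optDp rl rv suml.
exists c => n; have [->//|[p [Dpp sp]]] := busy_beaver_witness (x n) surjD.
set N := busy_beaver D (x n) in Dpp *.
pose r := string_code p.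
(* At the least stage where the program has qualified and [Y n] has reached its limit, one of the
   two has just happened, so a request of length exactly [y n] is issued there. *)
have /ex_minnP[t /andP[ct /eqP Yt] tmin] : exists t, cond n r t && (Y n t == y n).
  have [K1 h1] := (cvg_natP _ _).1 (limX n).
  have [K2 h2] := (cvg_natP _ _).1 (limY n).
  have [K3 h3] := (evT p N).1 Dpp.
  exists (maxn K1 (maxn K2 K3)); rewrite h2 ?eqxx ?andbT; last first.
    by rewrite !leq_max leqnn orbT.
  rewrite /cond h1 ?leq_maxl // (monoT K3 _ _ N) ?andbT //.
    exact: string_code_lt.
  by rewrite !leq_max leqnn !orbT.
have TN : T t r = N.+1.
  case/andP: ct => _; case E: (T t r) => [//|z] _; congr _.+1.
  have : D p = Some z by apply/evT; exists t.
  by rewrite Dpp => -[].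
have newt : new n r t.
  rewrite /new /fresh ct /=; case: t ct Yt tmin {TN} => [//|t] ct Yt tmin /=.
  case ct': (cond n r t) => //=; rewrite Yt ltn_neqAle geY andbT.
  by apply/eqP => Yt'; have := tmin t; rewrite ct' -Yt' eqxx ltnn => /(_ isT).
have [E2 E3 E5] := triple_codeK n r t.
have [q [Dq sq]] := hc (triple_code n r t).
have li : l (triple_code n r t) = y n.
  by rewrite /l /real /is_triple_code E2 E3 E5 eqxx newt.
rewrite li /v E3 E5 TN /= in Dq sq.
apply: busy_beaver_ge; first exact: optimal_prefix_free_surjective.
exact: leq_trans (complexity_le Dq) sq.
Qed.

(** * The a priori probability *)

Lemma half_power_lower_semicomputable (R : realType) (k : nat -> nat) :
  upper_semicomputable_nat k ->
  lower_semicomputable_real (fun n => (2 : R) ^- k n).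
Proof.
move=> [K [rK monoK limK]].
exists (fun n t => 2 ^- K n t); split.
- exists (fun _ _ => 1%N), (fun _ _ => 0%N), (fun n t => (2 ^ K n t).-1).
  split; try by apply/computable2P; exact: recursive_const.
    by move/computable2P: rK => rK; apply/computable2P; recursive_tac.
  by move=> i j; rewrite subr0 div1r prednK ?expn_gt0 // natrX.
- by move=> n t t' le_tt'; apply: ler_half_powers; exact: monoK.
- move=> n; have [T hT] := (cvg_natP _ _).1 (limK n).
  apply: cvg_near_cst; exists T => // t /= /hT ->.
  by rewrite fmorphV rmorphXn /= ratr_nat.
Qed.

Lemma complexity_semicomputable_summable (R : realType) D :
  optimal_prefix_free_decompressor D ->
  semicomputable_summable (fun n => (2 : R) ^- complexity D n).
Proof.
move=> optD; have [cD pD _] := optD.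
have [c lin] := optimal_prefix_free_linear optD.
have e0 n : 0 <= (2 : R) ^- complexity D n by rewrite invr_ge0 exprn_ge0.
split=> //.
  exact/half_power_lower_semicomputable/(complexity_upper_semicomputable cD lin).
apply: nondecreasing_is_cvgn; first exact: nondecreasing_series.
exists 1 => _ [I _ <-]; apply: kraft_inequality => //.
exact: optimal_prefix_free_surjective.
Qed.

Lemma exists_lt_pow2 (R : realType) (x : R) : exists c : nat, x < 2 ^+ c.
Proof. by exists (Num.bound x); exact: upper_nthrootP. Qed.

Lemma a_priori_ge (R : realType) D (m : nat -> R) :
  optimal_prefix_free_decompressor D -> a_priori_probability m ->
  exists c : nat, forall N, 2 ^- complexity D N <= 2 ^+ c * m N.
Proof.
move=> optD [[_ m0 _] maxm].
have [C [C0 hC]] := maxm _ (complexity_semicomputable_summable R optD).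
have [c Cc] := exists_lt_pow2 C; exists c => N.
by apply: le_trans (hC N) _; rewrite ler_wpM2r // ltW.
Qed.

Lemma nneseries_le_partial (R : realType) (u : nat -> R) N (b : R) :
  (forall k, 0 <= u k) -> (forall j, \sum_(N <= k < j) u k <= b) ->
  (\sum_(N <= k <oo) (u k)%:E <= b%:E)%E.
Proof.
move=> u0 ub; apply: lime_le.
  by apply: is_cvg_nneseries => k _ _; rewrite lee_fin.
by near=> j; rewrite sumEFin lee_fin.
Unshelve. all: by end_near.
Qed.

(* If [i / 2 ^ n] is below the total mass but within [2 ^- n] of it, then
   waiting until the enumerated mass exceeds [i / 2 ^ n] gives a stage [t] such
   that the terms beyond [t] have mass less than [2 ^- n]; [n] and [i] are given
   by a string of length [n + O(1)]. The enumerated mass is [Num t / Den t]. *)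
Lemma tail_cutoff (R : realType) D (m : nat -> R) :
  optimal_decompressor D -> semicomputable_summable m ->
  0 < limn (series m) ->
  exists c, forall n, exists N,
    (\sum_(N.+1 <= k <oo) (m k)%:E < (2 ^- n)%:E)%E /\
    (N <= busy_beaver D (n + c))%N.
Proof.
move=> optD [[q [[a [b [d [ra rb rd qE]]]] monoq limq]] m0 cvgm] S0.
set S : R := limn (series m) in S0 *.
have e0 k : 0 < (2 : R) ^+ k by exact: exprn_gt0.
have [c0 Sc0] := exists_lt_pow2 S.
pose Den t := (\prod_(0 <= j < t) (d j t).+1)%N.
(* Truncated subtraction replaces a negative approximation by 0. It stays below [m k] because [m k]
   is nonnegative, and the enumerated mass becomes a quotient of naturals. *)
pose Num t := (\sum_(0 <= k < t) (a k t - b k t) * (Den t %/ (d k t).+1))%N.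
pose qp k t : R := (a k t - b k t)%N%:R / (d k t).+1%:R.
have Den0 t : 0 < (Den t)%:R :> R by rewrite ltr0n prodn_gt0.
have NumE t : (Num t)%:R / (Den t)%:R = \sum_(0 <= k < t) qp k t.
  rewrite natr_sum mulr_suml; apply: eq_big_nat => k /andP[_ lt_kt].
  have /dvdnP[e eE] : ((d k t).+1 %| Den t)%N.
    by rewrite /Den big_mkord (bigD1 (Ordinal lt_kt)) //= dvdn_mulr.
  have := Den0 t; rewrite /qp eE mulnK // !natrM => ed0.
  have [e00 d00] : (e%:R : R) != 0 /\ ((d k t).+1%:R : R) != 0.
    by apply/andP; rewrite -negb_or -mulf_eq0 lt0r_neq0.
  by rewrite invfM mulrA mulfK.
have ratrE k t : ratr (q k t) = ((a k t)%:R - (b k t)%:R) / (d k t).+1%:R :> R.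
  by rewrite qE fmorph_div rmorphB /= !ratr_nat.
have q_le k t : ratr (q k t) <= qp k t.
  rewrite ratrE ler_pM2r ?invr_gt0 ?ltr0n //.
  case: (leqP (b k t) (a k t)) => [le_ba|/ltnW le_ab]; first by rewrite natrB.
  by rewrite (eqP le_ab) subr_le0 ler_nat.
have qp_le k t : qp k t <= m k.
  have : ratr (q k t) <= m k.
    have /cvg_lim <- // := limq k.
    apply: nondecreasing_cvgn_le; last by apply/cvg_ex; exists (m k).
    by move=> i j /monoq; rewrite ler_rat.
  rewrite ratrE /qp; case: (leqP (b k t) (a k t)) => [le_ba|/ltnW le_ab].
    by rewrite natrB.
  by rewrite (eqP le_ab) mul0r.
have qp0 k t : 0 <= qp k t by rewrite divr_ge0.
have le_S t : series m t <= S.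
  by apply: nondecreasing_cvgn_le => //; exact: nondecreasing_series.
(* Some [K] terms of the series already exceed [e], and so do good approximations of them; the
   further terms counted at a later stage are nonnegative. *)
have approx (e : R) : e < S -> exists t, e < (Num t)%:R / (Den t)%:R.
  move=> eS; have [K _ /(_ K (leqnn _)) eK] := @cvgr_gt _ _ _ _ (series m) S cvgm e eS.
  have cvgq : \sum_(0 <= k < K) (ratr (q k t) : R) @[t --> \oo] --> series m K.
    by apply: cvg_big => // ; exact: add_continuous.
  have [T _ hT] := @cvgr_gt _ _ _ _ _ _ cvgq e eK; exists (maxn K T).
  apply: lt_le_trans (hT (maxn K T) (leq_maxr _ _)) _; rewrite NumE.
  apply: le_trans (ler_sum _ (fun k _ => q_le k _)) _.
  by rewrite [leRHS](big_cat_nat _ (leq_maxl K T)) //= lerDl sumr_ge0.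
(* The string has length [n + c0] with [c0] fixed, so its length conveys [n] and its value conveys
   [i]. *)
pose M t c := (code_val c * 2 ^ c0 * Den t < Num t * 2 ^ code_size c)%N.
have MP t p n : size p = (n + c0)%N -> M t (string_code p) =
    ((bits_val p)%:R / 2 ^+ n < (Num t)%:R / (Den t)%:R :> R).
  move=> sp; rewrite /M code_valE code_sizeE sp -(ltr_nat R) !natrM !natrX exprD.
  rewrite ltr_pdivrMr // [X in _ = (_ < X)]mulrAC ltr_pdivlMr // mulrA.
  rewrite [X in (X < _) = _]mulrAC.
  by rewrite ltr_pM2r.
have [||D' [cD' hD']] := @search_decompressor M id.
- move/computable2P: ra => ra; move/computable2P: rb => rb.
  move/computable2P: rd => rd.
  have rD : recursive 1 (fun w => Den (head 0%N w)).
    apply: recursive_prod_nat; last by recursive_tac.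
    by apply: recursive_S; apply: (@recursive_comp2 _ d) => //; recursive_tac.
  have rN : recursive 1 (fun w => Num (head 0%N w)).
    apply: recursive_sum_nat; last by recursive_tac.
    apply: recursive_mul; [apply: recursive_sub | apply: recursive_div].
    + by apply: (@recursive_comp2 _ a) => //; recursive_tac.
    + by apply: (@recursive_comp2 _ b) => //; recursive_tac.
    + by apply: (@recursive_comp1 _ Den) => //; recursive_tac.
    + by apply: recursive_S; apply: (@recursive_comp2 _ d) => //; recursive_tac.
  have rD2 := @recursive_comp1 2 Den _ rD (recursive_var0 1).
  have rN2 := @recursive_comp1 2 Num _ rN (recursive_var0 1).
  have rv2 := recursive_code_val (recursive_var1 0).
  have rs2 := recursive_code_size (recursive_var1 0).
  by rewrite /M; recursive_tac.
- exact: recursive_var0.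
have [c1 hc1] := optD.2 _ cD'; exists (c0 + c1)%N => n.
(* [i.+1] is the least natural number not below [S * 2 ^+ n]; it is nonzero because the total mass
   is positive. *)
have [i [iS Si]] : exists i : nat, i%:R / 2 ^+ n < S /\ S <= i.+1%:R / 2 ^+ n.
  have /ex_minnP[k Sk kmin] : exists k : nat, S * 2 ^+ n <= k%:R.
    by exists (Num.bound (S * 2 ^+ n)); rewrite ltW // archi_boundP // mulr_ge0 // ltW.
  case: k Sk kmin => [|k] Sk kmin.
    by have := mulr_gt0 S0 (e0 n); rewrite ltNge Sk.
  exists k; rewrite ltr_pdivrMr // ler_pdivlMr //; split=> //.
  by rewrite ltNge; apply/negP => /kmin; rewrite ltnn.
have [p [sp vp]] : exists p, size p = (n + c0)%N /\ bits_val p = i.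
  apply: bits_val_surj; rewrite -(ltr_nat R) natrX exprD mulrC -ltr_pdivrMr //.
  exact: lt_trans Sc0.
have [t0 ht0] := approx _ iS.
have Mt0 : exists t, M t (string_code p) by exists t0; rewrite (MP _ _ n) // vp.
have [t Mt tmin] := ex_minnP Mt0.
have D't : D' p = Some t.
  apply/hD'; exists t; split=> // j lt_jt.
  by apply/negP => /tmin; rewrite leqNgt lt_jt.
have [r [Dr sr]] := hc1 _ _ D't.
exists t; split; last first.
  apply: busy_beaver_ge; first exact: optimal_surjective.
  by apply: leq_trans (complexity_le Dr) _; lia.
move: Mt; rewrite (MP _ _ n) // vp NumE => it.
(* [series m t] stops before the term [m t] and the tail starts after it; dropping this nonnegative
   term only helps. *)
apply: (@le_lt_trans _ _ (S - series m t)%:E).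
  apply: nneseries_le_partial => // j; case: (leqP j t.+1) => [le_jt|lt_tj].
    by rewrite big_geq // subr_ge0.
  have <- := sub_series_geq m (ltnW lt_tj); apply: lerB; first exact: le_S.
  by rewrite /series /= big_nat_recr //= lerDl.
have : \sum_(0 <= k < t) qp k t <= series m t by apply: ler_sum.
move: Si; rewrite lte_fin -natr1 mulrDl mul1r; lra.
Qed.

(** Domination of [2 ^- complexity D 0] already forces [m 0] to be positive. *)
Lemma a_priori_mass_gt0 (R : realType) D (m : nat -> R) :
  optimal_prefix_free_decompressor D -> a_priori_probability m ->
  0 < limn (series m).
Proof.
move=> optD apm; have [c hc] := a_priori_ge optD apm.
have [[_ m0 cvgm] _] := apm.
have e0 k : 0 < (2 : R) ^+ k by exact: exprn_gt0.
have m00 : 0 < m 0.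
  by rewrite -(pmulr_rgt0 _ (e0 c)) (lt_le_trans _ (hc 0%N)) // invr_gt0.
apply: lt_le_trans m00 _; have -> : m 0 = series m 1 by rewrite /series /= big_nat1.
by apply: nondecreasing_cvgn_le => //; exact: nondecreasing_series.
Qed.

(** * Monotonicity, and the bound of BP by BP' *)

Lemma busy_beaver_mono D : (forall k, exists p, D p = Some k) ->
  {homo busy_beaver D : i j / (i <= j)%N}.
Proof.
move=> surjD i j le_ij; have [->//|[p [Dp sp]]] := busy_beaver_witness i surjD.
apply: busy_beaver_ge => //; apply: leq_trans (complexity_le Dp) _.
exact: leq_trans le_ij.
Qed.

(** The existence of one cutoff excludes the default value of [nat_min]; [tail_cutoff] supplies
    it. *)
Lemma busy_beaver_tailP (R : realType) (m : nat -> R) n :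
  (exists N, (\sum_(N.+1 <= k <oo) (m k)%:E < (2 ^- n)%:E)%E) ->
  (\sum_((busy_beaver_tail m n).+1 <= k <oo) (m k)%:E < (2 ^- n)%:E)%E.
Proof.
move=> [N tN]; pose A := [set N | (\sum_(N.+1 <= k <oo) (m k)%:E < (2 ^- n)%:E)%E].
exact: (@nat_minP A N tN).1.
Qed.

Lemma busy_beaver_tail_le (R : realType) (m : nat -> R) n N :
  (\sum_(N.+1 <= k <oo) (m k)%:E < (2 ^- n)%:E)%E ->
  (busy_beaver_tail m n <= N)%N.
Proof.
move=> tN; pose A := [set N | (\sum_(N.+1 <= k <oo) (m k)%:E < (2 ^- n)%:E)%E].
exact: (@nat_minP A N tN).2.
Qed.

(** With [busy_beaver_mono], this allows the constants of the two inequalities in (i) to be replaced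
    by their maximum. *)
Lemma busy_beaver_tail_mono (R : realType) (m : nat -> R) :
  (forall n, exists N, (\sum_(N.+1 <= k <oo) (m k)%:E < (2 ^- n)%:E)%E) ->
  {homo busy_beaver_tail m : i j / (i <= j)%N}.
Proof.
move=> tails i j le_ij; apply: busy_beaver_tail_le.
apply: lt_le_trans (busy_beaver_tailP (tails j)) _.
by rewrite lee_fin ler_half_powers.
Qed.

Lemma busy_beaver_le_tail (R : realType) D (m : nat -> R) :
  optimal_prefix_free_decompressor D -> a_priori_probability m ->
  (forall n, exists N, (\sum_(N.+1 <= k <oo) (m k)%:E < (2 ^- n)%:E)%E) ->
  exists c, forall n, (busy_beaver D n <= busy_beaver_tail m (n + c))%N.
Proof.
move=> optD apm tails; have [c hc] := a_priori_ge optD apm.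
have [[_ m0 _] _] := apm; exists c => n.
have surjD := optimal_prefix_free_surjective optD.
have [->//|[p [Dp sp]]] := busy_beaver_witness n surjD.
set N := busy_beaver D n in Dp *.
have := busy_beaver_tailP (tails (n + c)%N).
set N' := busy_beaver_tail _ _ => tN'.
rewrite leqNgt; apply/negP => lt_N'N.
have /le_lt_trans/(_ tN') : ((m N)%:E <= \sum_(N'.+1 <= k <oo) (m k)%:E)%E.
  apply: le_trans (@nneseries_lim_ge _ _ xpredT N'.+1 N.+1 _); last first.
    by move=> k _ _; rewrite lee_fin.
  rewrite big_nat_recr //= leeDr // sumEFin lee_fin.
  by apply: sumr_ge0.
rewrite lte_fin ltNge => /negP; apply.
have e0 k : 0 < (2 : R) ^+ k by exact: exprn_gt0.
rewrite exprD invfM ler_pdivrMr // mulrC; apply: le_trans (hc N).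
exact/ler_half_powers/(leq_trans (complexity_le Dp)).
Qed.

(** * The sequences n and n + KP(n), and the three statements *)

Lemma identity_lower_semicomputable : lower_semicomputable_nat id.
Proof.
exists (fun n _ => n); split=> [||n]; last by apply/cvg_natP; exists 0%N.
  by apply/computable2P; exact: recursive_var0.
by move=> n t t' _; exact: lexx.
Qed.

Lemma addn_upper_semicomputable (k : nat -> nat) : upper_semicomputable_nat k ->
  upper_semicomputable_nat (fun n => n + k n)%N.
Proof.
move=> [K [rK monoK limK]]; exists (fun n t => n + K n t)%N; split.
- by move/computable2P: rK => rK; apply/computable2P; recursive_tac.
- by move=> n t t' le_tt'; rewrite leEnat leq_add2l; exact: monoK.
- move=> n; have [T hT] := (cvg_natP _ _).1 (limK n).
  by apply/cvg_natP; exists T => t /hT ->.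
Qed.

Theorem theorem1 (R : realType) (D Dp : seq bool -> option nat) (m : nat -> R)
  (optD : optimal_decompressor D)
  (optDp : optimal_prefix_free_decompressor Dp)
  (apm : a_priori_probability m) :
  let KP := complexity Dp in
  let B := busy_beaver D in
  let BP := busy_beaver Dp in
  let BP' := busy_beaver_tail m in
  [/\ exists c : nat, forall n : nat,
        (BP n <= BP' (n + c))%N /\ (BP' n <= B (n + c))%N,
      exists c : nat, forall n : nat, (B n <= BP (n + KP n + c))%N
    & forall x y : nat -> nat,
        (forall n, (x n <= y n)%N) ->
        lower_semicomputable_nat x ->
        upper_semicomputable_nat y ->
        (\sum_(0 <= n <oo) ((2 : R) ^ ((x n)%:Z - (y n)%:Z))%:E < +oo)%E ->
        exists c : nat, forall n : nat, (B (x n) <= BP (y n + c))%N].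
Proof.
move=> KP B BP BP'.
have cD := optD.1; have surjD := optimal_surjective optD.
have surjDp := optimal_prefix_free_surjective optDp.
have [cDp pDp _] := optDp.
split.
- have [c2 tailN] := tail_cutoff optD apm.1 (a_priori_mass_gt0 optDp apm).
  have tails n : exists N, (\sum_(N.+1 <= k <oo) (m k)%:E < (2 ^- n)%:E)%E.
    by have [N [tN _]] := tailN n; exists N.
  have [c1 hc1] := busy_beaver_le_tail optDp apm tails.
  exists (maxn c1 c2) => n; split.
    apply: leq_trans (hc1 n) _; apply: busy_beaver_tail_mono => //.
    by rewrite leq_add2l leq_maxl.
  have [N [tN leN]] := tailN n.
  apply: leq_trans (busy_beaver_tail_le tN) _; apply: leq_trans leN _.
  by apply: busy_beaver_mono => //; rewrite leq_add2l leq_maxr.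
- have [c lin] := optimal_prefix_free_linear optDp.
  (* Here the cost [2 ^+ n / 2 ^+ (n + KP n)] equals [2 ^- KP n], so Kraft's inequality gives the
     bound 1, that is, [C = 0]. *)
  apply: (@busy_beaver_le_prefix R D Dp id (fun n => n + KP n)%N 0) => //.
  + exact: identity_lower_semicomputable.
  + exact/addn_upper_semicomputable/(complexity_upper_semicomputable cDp lin).
  + move=> I; rewrite expr0; apply: le_trans (kraft_inequality R pDp surjDp I).
    rewrite big_mkord; apply: ler_sum => n _.
    by rewrite exprD invfM mulrA mulfV ?mul1r // lt0r_neq0 ?exprn_gt0.
- move=> x y le_xy lx uy sum_fin.
  have w0 n : 0 <= (2 : R) ^ ((x n)%:Z - (y n)%:Z) by exact: exprz_ge0.
  have [C hC] : exists C : nat, forall I,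
      \sum_(n < I) (2 : R) ^ ((x n)%:Z - (y n)%:Z) <= 2 ^+ C.
    move: sum_fin; case E: (\sum_(0 <= n <oo) _)%E => [s| |] // _; last first.
      have : (0 <= \sum_(0 <= n <oo) ((2 : R) ^ ((x n)%:Z - (y n)%:Z))%:E)%E.
        by apply: nneseries_ge0 => n _ _; rewrite lee_fin.
      by rewrite E.
    have [C sC] := exists_lt_pow2 s; exists C => I; apply: le_trans (ltW sC).
    rewrite -lee_fin -E -sumEFin.
    rewrite -(big_mkord xpredT (fun n => ((2 : R) ^ ((x n)%:Z - (y n)%:Z))%:E)).
    by apply: nneseries_lim_ge => n _ _; rewrite lee_fin.
  apply: (@busy_beaver_le_prefix R D Dp x y C) => // I.
  apply: le_trans (hC I); apply: ler_sum => n _.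
  by rewrite expfzDr // -invr_expz.
Qed.
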